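(* Let $N\subset\mathbb Z^n$ be the set of all lattice points of a convex polytope in $\mathbb R^n$ and let $h:\mathbb Z^n\to\mathbb Z$ be the last coordinate. For general $f\in\mathbb C^N$, let $p:\{f=0\}\to(\mathbb C^* )^{n-1}$ be the projection of the hypersurface $\{f=0\}\subset(\mathbb C^* )^n$ forgetting the last coordinate. Then, for $1\le i<|h(N)|$, the $i$-th Thom--Boardman stratum of $p$ is given by the equations $$f(x)=\partial f/\partial x_n=\cdots=\partial^i f/\partial x_n^i=0.$$
   Context: $\mathbb C^N$ is the space of Laurent polynomials $\sum_{b\in N}c_bx^b$; ''general'' means: for all $f$ in some nonempty Zariski open subset of $\mathbb C^N$. For a smooth map $F:M\to M'$, the Thom--Boardman stratum $S_1\subset M$ is the critical locus of $F$, and for $i>1$ the stratum $S_i$ is the rank drop locus of $dF$ restricted to $S_{i-1}$ (provided that $S_{i-1}$ is smooth). *)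

(* Defs.v *)
From HB Require Import structures.
From mathcomp Require Import all_boot all_order all_algebra.
From mathcomp Require Import finmap complex.
From mathcomp Require mpoly.
From mathcomp Require Import boolp classical_sets reals topology normedtype derive.

Set Implicit Arguments.
Unset Strict Implicit.
Unset Printing Implicit Defensive.

Import Order.TTheory GRing.Theory Num.Theory.
Import numFieldNormedType.Exports.

Local Open Scope classical_set_scope.
Local Open Scope ring_scope.

Definition polytope (R : realType) (n : nat) (V : seq 'rV[R]_n) : set 'rV[R]_n :=
  [set y | exists w : 'I_(size V) -> R,
     [/\ forall i, 0 <= w i, \sum_i w i = 1 & y = \sum_i w i *: V`_i]].

Definition is_lattice_points (R : realType) (n : nat)
    (P : set 'rV[R]_n) (N : {fset 'rV[int]_n}) : Prop :=
  forall b : 'rV[int]_n, b \in N <-> P (map_mx (fun z : int => z%:~R) b).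

Definition last_coord (n : nat) (b : 'rV[int]_n.+1) : int := b 0 ord_max.

(* C^N is represented by the coefficient vectors {ffun N -> C}. *)
Definition laurent (C : numFieldType) (n : nat) (N : {fset 'rV[int]_n})
    (c : {ffun N -> C}) (x : 'rV[C]_n) : C^o :=
  \sum_(b : N) c b * \prod_(l < n) x 0 l ^ (val b) 0 l.

(* The open sets of the Zariski topology on the affine space C^I: complements
   of common zero sets of arbitrary families of polynomials. *)
Definition zariski_open (C : numFieldType) (I : finType)
    (U : set {ffun I -> C}) : Prop :=
  exists E : set (mpoly.mpoly #|I| C),
    U = [set c | exists2 P, E P &
                   mpoly.meval (fun j : 'I_#|I| => c (enum_val j)) P != 0].

Definition torus (C : numFieldType) (n : nat) : set 'rV[C]_n :=
  [set x | forall l, x 0 l != 0].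

Definition forget_last (C : numFieldType) (n : nat) (x : 'rV[C]_n.+1) : 'rV[C]_n :=
  \row_(j < n) x 0 (lift ord_max j).

Definition dlast (C : numFieldType) (n : nat) (f : 'rV[C]_n.+1 -> C^o)
    (y : 'rV[C]_n.+1) : C^o :=
  'D_(delta_mx 0 ord_max) f y.

(* Submanifolds of affine space are embedded ones, and over C = R[i] the
   predicate differentiable means complex differentiable, so g below is
   holomorphic near x.  Jacobians act on row vectors from the right: for
   g : C^n -> C^k, 'J g x is an n x k matrix and v *m 'J g x = dg_x(v). *)
Definition local_equations (C : numFieldType) (n k : nat) (S : set 'rV[C]_n)
    (x : 'rV[C]_n) (g : 'rV[C]_n -> 'rV[C]_k) : Prop :=
  [/\ \forall y \near x, differentiable g y,
      \forall y \near x, (S y <-> g y = 0) &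
      \rank ('J g x) = k].

Definition smooth (C : numFieldType) (n : nat) (S : set 'rV[C]_n) : Prop :=
  forall x, S x -> exists k (g : 'rV[C]_n -> 'rV[C]_k), local_equations S x g.

(* The row space of T is the tangent space of S at x.  It does not depend on
   the choice of local equations, by the implicit function theorem. *)
Definition is_tangent_space (C : numFieldType) (n : nat) (S : set 'rV[C]_n)
    (x : 'rV[C]_n) (T : 'M[C]_n) : Prop :=
  exists k (g : 'rV[C]_n -> 'rV[C]_k),
    local_equations S x g /\ (T == kermx ('J g x))%MS.

(* For T spanning the tangent space of S at x, the row space of T *m 'J F x is
   the image of the differential of F restricted to S. *)
Definition critical_locus (C : numFieldType) (n m : nat)
    (F : 'rV[C]_n -> 'rV[C]_m) (S : set 'rV[C]_n) : set 'rV[C]_n :=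
  [set x | S x /\ exists T, is_tangent_space S x T /\
                            (\rank (T *m 'J F x) < m)%N].

Definition rank_drop_locus (C : numFieldType) (n m : nat)
    (F : 'rV[C]_n -> 'rV[C]_m) (S : set 'rV[C]_n) : set 'rV[C]_n :=
  [set x | S x /\ exists T, is_tangent_space S x T /\
                            (\rank (T *m 'J F x) < minn (\rank T) m)%N].

(* Strata of the restriction of F to M, indexed from 1; index 0 is M itself. *)
Fixpoint thom_boardman (C : numFieldType) (n m : nat)
    (F : 'rV[C]_n -> 'rV[C]_m) (M : set 'rV[C]_n) (i : nat) : set 'rV[C]_n :=
  match i with
  | 0%N => M
  | j.+1 => if j is 0%N then critical_locus F M
            else rank_drop_locus F (thom_boardman F M j)
  end.

(* The i-th stratum is meaningful only if M and the previous strata are smooth. *)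
Definition thom_boardman_defined (C : numFieldType) (n m : nat)
    (F : 'rV[C]_n -> 'rV[C]_m) (M : set 'rV[C]_n) (i : nat) : Prop :=
  forall j, (j < i)%N -> smooth (thom_boardman F M j).

(* Main.v *)
Require Import Defs.
From HB Require Import structures.
From mathcomp Require Import all_boot all_order all_algebra.
From mathcomp Require Import ring lra zify.
From mathcomp Require Import finmap complex.
From mathcomp Require Import ring_quotient generic_quotient.
From mathcomp Require mpoly.
Import -(notations) mpoly.
From mathcomp Require Import boolp classical_sets functions filter reals ereal.
From mathcomp Require Import topology normedtype landau sequences derive realfun.
From mathcomp Require Import exp trigo measure lebesgue_measure lebesgue_integral.
From mathcomp Require Import ftc.

(** Write f_l for the Laurent polynomial whose coefficients are those of f times
    h(h - 1)...(h - l + 1); on the torus the l-th derivative of f with respect to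
    x_n is f_l / x_n^l, so the claim is about Z_j = {f_0 = ... = f_j = 0}.

    Generic regularity: if for a Zariski dense set of f the differentials of
    f_0, ..., f_j were dependent at some common zero x, with coefficients lam,
    an ultraproduct along that set would give a field L of characteristic 0
    containing algebraically independent coefficients c_b, a point x and a
    nonzero lam with the same property.  The derivation d/dc_b extends to
    x; applied to f_l(x) = 0 and combined with lam it yields
    sum_l lam_l h(b)(h(b) - 1)...(h(b) - l + 1) = 0 for every b, which is
    impossible since h takes more than j values.

    Tangent spaces: local equations g are only assumed to be complex
    differentiable near x.  Cauchy's estimate applied to g - dg_x on complex
    lines shows that g is strictly differentiable at x, so by a contraction
    argument every vector of ker dg_x is tangent to {g = 0}; hence ker dg_x
    depends only on the set.

    For regular f the differential of p drops rank on ker dg_x, where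
    g = (f_0, ..., f_j), exactly when this kernel contains the last basis
    vector, that is when f_(j+1)(x) = 0. *)

Set Implicit Arguments.
Unset Strict Implicit.
Unset Printing Implicit Defensive.

Import Order.TTheory GRing.Theory Num.Theory.
Import numFieldNormedType.Exports.

Local Open Scope classical_set_scope.
Local Open Scope ring_scope.
Local Open Scope quotient_scope.

(** Genericity: the derivative of [x] with respect to c_b is unknown, but it enters only through the
    differentials of the f_l at [x]. The combination [lam] that makes these dependent removes it,
    and only the explicit dependence of f_l on c_b survives. This does the work of a Bertini or Sard
    theorem without dimension theory. The contradiction is read off at actual coefficients, because
    an identity in the ultraproduct holds at some member of the family.

    Tangent spaces: [is_tangent_space] quantifies existentially over local equations, so a stratum
    could a priori depend on an odd choice of g. Independence of that choice is what requires
    analysis, as g comes without a continuous derivative.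

    Dimension: regularity gives j + 1 independent differentials in n + 1 variables at every point of
    Z_j, so strata too deep for the dimension are empty and need no separate case. *)

(** * Extending derivations *)

(** A derivation of the subring [phi A] of [L] with values in [L], carried by [A] so that no subring
    has to be formed: the third clause makes [delta a] depend on [phi a] only. Adjoining z then just
    replaces [A] by [{poly A}]. *)
Definition derivation_along (A L : comNzRingType) (phi : {rmorphism A -> L})
    (delta : A -> L) : Prop :=
  [/\ forall a b, delta (a + b) = delta a + delta b,
      forall a b, delta (a * b) = phi a * delta b + delta a * phi b &
      forall a, phi a = 0 -> delta a = 0].

Section Derivation.
Variables (A : comNzRingType) (L : fieldType) (phi : {rmorphism A -> L}).
Variable delta : A -> L.
Hypothesis delta_der : derivation_along phi delta.

Lemma derivation_along0 : delta 0 = 0.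
Proof. by case: delta_der => _ _; apply; rewrite rmorph0. Qed.

Lemma derivation_alongD a b : delta (a + b) = delta a + delta b.
Proof. by case: delta_der. Qed.

Lemma derivation_alongM a b : delta (a * b) = phi a * delta b + delta a * phi b.
Proof. by case: delta_der. Qed.

Lemma derivation_alongN a : delta (- a) = - delta a.
Proof.
by apply/eqP; rewrite -subr_eq0 opprK -derivation_alongD addNr derivation_along0.
Qed.

Lemma derivation_along_inj a b : phi a = phi b -> delta a = delta b.
Proof.
move=> ab; apply/eqP; rewrite -subr_eq0 -derivation_alongN -derivation_alongD.
by case: delta_der => _ _ ->//; rewrite rmorphB ab subrr.
Qed.

Variable z : L.

(** The value that an extended derivation must take at P(z) once [y] is prescribed at [z]. *)
Definition poly_delta y (P : {poly A}) : L :=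
  (map_poly delta P).[z] + (map_poly phi P)^`().[z] * y.

Lemma poly_deltaD y P Q : poly_delta y (P + Q) = poly_delta y P + poly_delta y Q.
Proof.
rewrite /poly_delta rmorphD /= derivD hornerD mulrDl.
have -> : map_poly delta (P + Q) = map_poly delta P + map_poly delta Q.
  apply/polyP => i; rewrite coefD !coef_map_id0 ?derivation_along0//.
  by rewrite coefD derivation_alongD.
by rewrite hornerD addrACA.
Qed.

Lemma poly_delta0 y : poly_delta y 0 = 0.
Proof.
rewrite /poly_delta.
have -> : map_poly delta 0 = 0.
  by apply/polyP => i; rewrite coef_map_id0 ?coef0 ?derivation_along0.
by rewrite rmorph0 deriv0 !horner0 mul0r addr0.
Qed.

Lemma poly_delta_monomM y a i Q :
  poly_delta y (a *: 'X^i * Q) =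
  phi a * z ^+ i * poly_delta y Q + poly_delta y (a *: 'X^i) * (map_poly phi Q).[z].
Proof.
have E P : map_poly delta (a *: 'X^i * P) =
    'X^i * (phi a *: map_poly delta P + delta a *: map_poly phi P).
  apply/polyP => j; rewrite coef_map_id0 ?derivation_along0//.
  rewrite -scalerAl coefZ !coefXnM derivation_alongM.
  case: ifP => _; first by rewrite derivation_along0 rmorph0 !mulr0 addr0.
  by rewrite coefD !coefZ !coef_map_id0 ?derivation_along0// rmorph0.
rewrite /poly_delta E -[a *: 'X^i in RHS]mulr1 E.
have -> : map_poly delta 1 = 0.
  apply/polyP => j; rewrite coef_map_id0 ?derivation_along0// coef0 coef1.
  case: (j == 0)%N; last by rewrite derivation_along0.
  have := derivation_alongM 1 1; rewrite mulr1 rmorph1 mulr1 mul1r => /eqP.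
  by rewrite -subr_eq0 opprD addNKr oppr_eq0 => /eqP.
rewrite mulr1 rmorphM /= rmorph1 scaler0 add0r !linearZ /= map_polyXn derivM derivZ.
rewrite !hornerE /=; ring.
Qed.

Lemma poly_deltaM y P Q :
  poly_delta y (P * Q) =
  (map_poly phi P).[z] * poly_delta y Q + poly_delta y P * (map_poly phi Q).[z].
Proof.
elim/poly_ind: P => [|P c IHP].
  by rewrite poly_delta0 rmorph0 horner0 !mul0r poly_delta0 addr0.
have -> : P * 'X + c%:P = 1 *: 'X^1 * P + c *: 'X^0.
  by rewrite scale1r expr1 commr_polyX expr0 alg_polyC.
have -> : (map_poly phi (1 *: 'X^1 * P + c *: 'X^0)).[z] =
    z * (map_poly phi P).[z] + phi c.
  by rewrite rmorphD rmorphM /= !linearZ /= !map_polyXn rmorph1 !hornerE.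
rewrite mulrDl -mulrA !poly_deltaD !poly_delta_monomM IHP rmorphM rmorph1 /=.
rewrite hornerM; move: (poly_delta _ _) (poly_delta _ _) => /= d0 d1.
by rewrite expr1 expr0; ring.
Qed.

Hypothesis charL0 : forall n : nat, n.+1%:R != 0 :> L.

(* The value y of the derivative at z is forced by a polynomial of minimal
   degree killing z, which is separable at z in characteristic zero. *)
Lemma derivation_extend :
  exists y, derivation_along (horner_eval z \o map_poly phi) (poly_delta y).
Proof.
suff [y yP] : exists y, forall P, (map_poly phi P).[z] = 0 -> poly_delta y P = 0.
  exists y; split; [exact: poly_deltaD|exact: poly_deltaM|].
  by move=> P; rewrite /= /horner_eval => /yP.
(* [phi] may kill the leading coefficient. Removing that term changes neither the value at [z] nor
   [poly_delta], which allows induction on the size. *)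
have lowcoef P : phi (lead_coef P) = 0 -> P != 0 -> exists2 Q : {poly A},
    (size Q < size P)%N & (map_poly phi Q).[z] = (map_poly phi P).[z] /\
    forall y, poly_delta y Q = poly_delta y P.
  move=> lP P0; have sP : (0 < size P)%N by rewrite size_poly_gt0.
  have E i : (take_poly (size P).-1 P)`_i =
      if i == (size P).-1 then 0 else P`_i.
    rewrite coef_take_poly; case: ltngtP => // + //; rewrite prednK// => h.
    by rewrite nth_default.
  have Ephi : map_poly phi (take_poly (size P).-1 P) = map_poly phi P.
    apply/polyP => i; rewrite !coef_map E; case: eqP => // ->.
    exact: etrans (rmorph0 phi) (esym lP).
  have Edel : map_poly delta (take_poly (size P).-1 P) = map_poly delta P.
    apply/polyP => i; rewrite !coef_map_id0 ?derivation_along0// E.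
    case: eqP => // ->; rewrite derivation_along0 -lead_coefE.
    by case: delta_der => _ _ ->.
  exists (take_poly (size P).-1 P).
    by rewrite -[X in (_ < X)%N](prednK sP) ltnS size_take_poly.
  by rewrite /poly_delta Ephi Edel.
(* Without such a [mu], [z] is transcendental over [phi A]; any [y] works, and 0 is taken. *)
have [[m [mu [smu zmu lmu]]]|nomu] := pselect (exists m (mu : {poly A}),
    [/\ size mu = m, (map_poly phi mu).[z] = 0 & phi (lead_coef mu) != 0]); last first.
  exists 0 => P; have [k] := ubnP (size P); elim: k P => // k IHk P sPk zP.
  have [->|P0] := eqVneq P 0; first by rewrite poly_delta0.
  have [/lowcoef/(_ P0)[Q sQ [QP <-]]|lP] := eqVneq (phi (lead_coef P)) 0.
    by apply: IHk; [exact: leq_trans sQ _|rewrite QP].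
  by case: nomu; exists (size P), P.
have {m mu smu zmu lmu} [mu [zmu lmu mu_min]] : exists mu : {poly A},
    [/\ (map_poly phi mu).[z] = 0, phi (lead_coef mu) != 0 &
     forall P : {poly A}, (map_poly phi P).[z] = 0 -> phi (lead_coef P) != 0 ->
       (size mu <= size P)%N].
  elim/ltn_ind: m mu smu zmu lmu => m IHm mu smu zmu lmu.
  have [[P [sP zP lP]]|noP] := pselect (exists P : {poly A},
      [/\ (size P < m)%N, (map_poly phi P).[z] = 0 & phi (lead_coef P) != 0]).
    exact: (IHm _ sP P).
  exists mu; split=> // P zP lP; rewrite leqNgt; apply/negP => sP; apply: noP.
  by exists P; rewrite -smu.
(* Otherwise the derivative would contradict minimality: it has smaller size and, in characteristic
   zero, a leading coefficient that [phi] does not kill. *)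
have dmu : (map_poly phi mu)^`().[z] != 0.
  have smu : (1 < size mu)%N.
    rewrite ltnNge; apply: contra lmu => /size1_polyC mu0.
    by move: zmu; rewrite mu0 map_polyC hornerC lead_coefC => ->.
  rewrite deriv_map; apply: contraTneq isT => dz0.
  have ssz : (size mu^`() < size mu)%N by rewrite lt_size_deriv// -size_poly_gt0 ltnW.
  have lead_dmu : phi mu^`()`_(size mu).-2 != 0.
    rewrite coef_deriv -mulr_natl rmorphM rmorph_nat mulf_neq0//.
    by rewrite prednK -?lead_coefE//; case: (size mu) smu => [|[]].
  have sdmu : size mu^`() = (size mu).-1.
    apply/eqP; rewrite eqn_leq -ltnS prednK ?(ltnW smu)// ssz /=.
    rewrite leqNgt; apply: contra lead_dmu => h.
    by rewrite nth_default ?rmorph0//; case: (size mu) smu h => [|[]].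
  have := mu_min _ dz0; rewrite lead_coefE sdmu => /(_ lead_dmu).
  by rewrite leqNgt -sdmu ssz.
pose y := - (map_poly delta mu).[z] / (map_poly phi mu)^`().[z].
have ymu : poly_delta y mu = 0 by rewrite /poly_delta /y mulrC divfK// subrr.
exists y => P; have [k] := ubnP (size P); elim: k P => // k IHk P sPk zP.
have [->|P0] := eqVneq P 0; first by rewrite poly_delta0.
have [/lowcoef/(_ P0)[Q sQ [QP <-]]|lP] := eqVneq (phi (lead_coef P)) 0.
  by apply: IHk; [exact: leq_trans sQ _|rewrite QP].
have smuP := mu_min _ zP lP.
have smu0 : (0 < size mu)%N.
  by rewrite size_poly_gt0; apply: contraNneq lmu => ->; rewrite lead_coef0 rmorph0.
(* Leading coefficients in [A] need not be invertible, so [P] is multiplied by that of [mu] before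
   its top term is cancelled; [phi (lead_coef mu) != 0] undoes this at the end. *)
pose Q := lead_coef mu *: 'X^0 * P - lead_coef P *: 'X^(size P - size mu) * mu.
have sQ : (size Q < size P)%N.
  have sP0 : (0 < size P)%N by rewrite size_poly_gt0.
  rewrite -[X in (_ < X)%N](prednK sP0) ltnS; apply/leq_sizeP => i.
  rewrite /Q coefB -!scalerAl !coefZ !coefXnM subn0 ltn0.
  rewrite leq_eqVlt => /predU1P[<-|hi].
    have -> : ((size P).-1 < size P - size mu)%N = false by lia.
    have -> : ((size P).-1 - (size P - size mu))%N = (size mu).-1 by lia.
    by rewrite -!lead_coefE mulrC subrr.
  have -> : P`_i = 0 by rewrite nth_default// -(prednK sP0).
  case: ltnP => h; first by rewrite !mulr0 subrr.
  rewrite [mu`__]nth_default ?mulr0 ?subrr//.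
  by rewrite leq_subRL// subnK// -(prednK sP0).
have : poly_delta y Q = 0.
  apply: IHk; first exact: leq_trans sQ _.
  by rewrite rmorphB !rmorphM !hornerE zP zmu !mulr0 subrr.
rewrite /Q poly_deltaD -mulNr !poly_deltaM ymu zmu zP !mulr0 !addr0.
rewrite linearZ /= map_polyXn !hornerE /= => /eqP; rewrite mulf_eq0.
by rewrite (negPf lmu) => /eqP.
Qed.
End Derivation.

(** The ring grows with each adjoined element, so earlier elements are followed through lifts with
    the same image in [L] and the same derivative. *)
Lemma derivation_extend_seq (L : fieldType) (s : seq L)
    (charL0 : forall n : nat, n.+1%:R != 0 :> L)
    (A : comNzRingType) (phi : {rmorphism A -> L}) (delta : A -> L) :
  derivation_along phi delta ->
  exists (A' : comNzRingType) (phi' : {rmorphism A' -> L}) (delta' : A' -> L),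
    [/\ derivation_along phi' delta',
        forall a, exists2 a', phi' a' = phi a & delta' a' = delta a &
        forall z, z \in s -> exists a', phi' a' = z].
Proof.
elim: s A phi delta => [|z s IHs] A phi delta dd.
  by exists A, phi, delta; split=> // a; exists a.
have [y dy] := derivation_extend dd z charL0.
have [A' [phi' [delta' [dd' lift' mem']]]] := IHs _ _ _ dy.
exists A', phi', delta'; split=> //.
  move=> a; have [a' pa' da'] := lift' a%:P; exists a'.
    by rewrite pa' /= /horner_eval map_polyC hornerC.
  rewrite da' /poly_delta map_polyC derivC horner0 mul0r addr0.
  rewrite (_ : map_poly delta a%:P = (delta a)%:P) ?hornerC//.
  apply/polyP => i; rewrite coef_map_id0 ?(derivation_along0 dd)// !coefC.
  by case: (i == 0)%N => //; rewrite (derivation_along0 dd).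
move=> z'; rewrite inE => /predU1P[->|/mem'//].
have [a' pa' _] := lift' 'X; exists a'.
by rewrite pa' /= /horner_eval map_polyX hornerX.
Qed.

(** Logarithmic derivatives add up; writing the rule as [phi a * w] avoids division in [A]. *)
Lemma log_derivation_prod (A L : comNzRingType) (phi : {rmorphism A -> L})
    (delta : A -> L) (I : Type) (r : seq I) (a : I -> A) (w : I -> L) :
  derivation_along phi delta ->
  (forall i, delta (a i) = phi (a i) * w i) ->
  delta (\prod_(i <- r) a i) = phi (\prod_(i <- r) a i) * \sum_(i <- r) w i.
Proof.
move=> [dD dM dK] aw; elim: r => [|i r IHr].
  rewrite !big_nil mulr0; have := dM 1 1.
  by rewrite mulr1 rmorph1 mulr1 mul1r => /eqP; rewrite -subr_eq0 opprD addNKr oppr_eq0 => /eqP.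
by rewrite !big_cons dM aw IHr rmorphM; ring.
Qed.

(** Let w_s be the logarithmic derivative of x_s. Applying the derivation d/dc_b0 to F_l(x) = 0
    gives that the sum over s of w_s x_s dF_l/dx_s, plus alpha_l(b0) x^b0, is zero. Weighting by
    [lam l] kills the first terms, and x^b0 is invertible. The [lam l] are never differentiated, so
    only the x_s and their inverses are adjoined. *)
Lemma critical_combination_eq0 (L : fieldType)
    (charL0 : forall n : nat, n.+1%:R != 0 :> L)
    (A : comNzRingType) (phi : {rmorphism A -> L}) (delta : A -> L)
    (I : finType) (n k : nat) (e : I -> 'I_n -> int)
    (c : I -> A) (alpha : 'I_k -> I -> A) (b0 : I)
    (x : 'I_n -> L) (lam : 'I_k -> L) :
  derivation_along phi delta ->
  (forall b, delta (c b) = (b == b0)%:R) ->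
  (forall l b, delta (alpha l b) = 0) ->
  (forall s, x s != 0) ->
  (forall l, \sum_b phi (c b) * phi (alpha l b) * \prod_s x s ^ e b s = 0) ->
  (forall s, \sum_l lam l * (\sum_b phi (c b) * phi (alpha l b) *
                               (e b s)%:~R * \prod_s x s ^ e b s) = 0) ->
  \sum_l lam l * phi (alpha l b0) = 0.
Proof.
move=> dd dc dalpha x0 Fx0 dFx0.
have [A' [phi' [delta' [dd' lift' mem']]]] :=
  derivation_extend_seq (codom x ++ codom (fun s => (x s)^-1)) charL0 dd.
have [lft lftP] : {lft : A -> A' & forall a, phi' (lft a) = phi a /\ delta' (lft a) = delta a}.
  by apply: (@choice _ _ (fun a a' => phi' a' = phi a /\ delta' a' = delta a)) => a; have [a'] := lift' a; exists a'.
have /fin_all_exists[X XP] s : exists a', phi' a' = x s.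
  by apply: mem'; rewrite mem_cat codom_f.
have /fin_all_exists[Y YP] s : exists a', phi' a' = (x s)^-1.
  by apply: mem'; rewrite mem_cat (codom_f (fun s => (x s)^-1)) orbT.
have [dD dM dK] := dd'.
have d1 : delta' 1 = 0.
  by have := log_derivation_prod (I := 'I_0) [::] (a := fun=> 1) (w := fun=> 0) dd'; rewrite !big_nil mulr0; apply; case.
pose w s := delta' (X s) / x s.
have Xw s : delta' (X s) = phi' (X s) * w s by rewrite XP /w mulrC divfK.
have Yw s : delta' (Y s) = phi' (Y s) * - w s.
  have : delta' (X s * Y s) = 0.
    rewrite (derivation_along_inj dd' (b := 1)) ?d1// rmorphM XP YP divff ?rmorph1//.
  rewrite dM XP YP => /eqP; rewrite addr_eq0 => /eqP xY.
  by apply: (mulfI (x0 s)); rewrite xY /w; field.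
(* Exponents may be negative while [A'] is only a ring; the preimage [Y s] of the inverse serves for
   those. *)
pose Z (b : I) s := if e b s is Posz m then X s ^+ m else Y s ^+ (absz (e b s)).
have ZP b s : phi' (Z b s) = x s ^ e b s.
  rewrite /Z; case: (e b s) => m; first by rewrite rmorphXn XP.
  by rewrite rmorphXn YP exprVn.
have Zw b s : delta' (Z b s) = phi' (Z b s) * ((e b s)%:~R * w s).
  have pw a u m : delta' a = phi' a * u -> delta' (a ^+ m) = phi' (a ^+ m) * (m%:R * u).
    move=> au; have -> : a ^+ m = \prod_(0 <= i < m) a by rewrite prodr_const_nat subn0.
    rewrite (log_derivation_prod _ dd' (fun=> au)) sumr_const_nat.
    by rewrite subn0 mulr_natl.
  rewrite /Z; case: (e b s) => m; first exact: pw.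
  by rewrite (pw _ (- w s))// NegzE mulrNz mulrN mulNr.
pose M b := \prod_s Z b s.
have MP b : phi' (M b) = \prod_s x s ^ e b s.
  by rewrite rmorph_prod; apply: eq_bigr.
have Mw b : delta' (M b) = phi' (M b) * \sum_s (e b s)%:~R * w s.
  exact: (log_derivation_prod _ dd').
have eqF l : \sum_s w s * (\sum_b phi (c b) * phi (alpha l b) *
      (e b s)%:~R * \prod_s x s ^ e b s) + phi (alpha l b0) * \prod_s x s ^ e b0 s = 0.
  have : delta' (\sum_b lft (c b) * lft (alpha l b) * M b) = 0.
    apply: dK; rewrite rmorph_sum -[RHS](Fx0 l); apply: eq_bigr => b _.
    by rewrite !rmorphM MP !(lftP _).1.
  have d0 : delta' 0 = 0 by rewrite dK ?rmorph0.
  rewrite (big_morph delta' dD d0) => dF; rewrite -[RHS]dF.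
  under [RHS]eq_bigr => b _ do rewrite dM Mw MP dM rmorphM !(lftP _).1 !(lftP _).2 dalpha mulr0 add0r dc.
  rewrite big_split /=; congr (_ + _).
    under eq_bigr => s _ do rewrite mulr_sumr.
    rewrite exchange_big; apply: eq_bigr => b _ /=.
    rewrite mulrA mulr_sumr; apply: eq_bigr => s _; ring.
  rewrite (bigD1 b0)//= eqxx mul1r [X in _ = _ + X]big1 ?addr0// => b /negPf ->.
  by rewrite !mul0r.
pose G l s := \sum_b phi (c b) * phi (alpha l b) * (e b s)%:~R * \prod_s x s ^ e b s.
have : \sum_l (\sum_s w s * (lam l * G l s) +
    lam l * phi (alpha l b0) * \prod_s x s ^ e b0 s) = 0.
  apply: big1 => l _; rewrite -[RHS](mulr0 (lam l)) -[X in _ = _ * X](eqF l) mulrDr mulr_sumr mulrA.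
  by congr (_ + _); apply: eq_bigr => s _; exact: mulrCA.
rewrite big_split /= -mulr_suml exchange_big /= big1 => [|s _]; last first.
  by rewrite -mulr_sumr dFx0 mulr0.
rewrite add0r => /eqP; rewrite mulf_eq0 => /orP[/eqP//|].
by rewrite prodf_seq_eq0 => /hasP[s _ /=]; rewrite expfz_eq0 (negPf (x0 s)) andbF.
Qed.

(** * Generic regularity *)

Section Ultrapower.
Variables (T : pointedType) (C : fieldType) (U : set_system T).

Definition almost_zero (UU : UltraFilter U) : pred (T -> C) :=
  fun f => `[< U [set t | f t = 0] >].

Variable UU : UltraFilter U.

Lemma almost_zero_idealr : idealr_closed (almost_zero UU).
Proof.
split; rewrite /almost_zero ?unfold_in.
- by apply/asboolP; rewrite (_ : [set _ | _] = setT)//; [exact: filterT|apply/seteqP].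
- apply/asboolPn => U0; have := filter_ex U0.
  by case=> t /= /eqP; rewrite oner_eq0.
- move=> a f g; rewrite !unfold_in => /asboolP Uf /asboolP Ug.
  apply/asboolP; apply: filterS (filterI Uf Ug) => t [/= ft gt].
  by rewrite /GRing.add /GRing.mul /= ft gt mulr0 addr0.
Qed.

HB.instance Definition _ :=
  isIdealr.Build (T -> C) (almost_zero UU) almost_zero_idealr.

Definition ultrapower : Type :=
  {ideal_quot (almost_zero UU : idealr (T -> C : comNzRingType))}.
HB.instance Definition _ := GRing.ComNzRing.on ultrapower.

Definition upi (f : T -> C) : ultrapower := \pi_ultrapower f.

Lemma upi_eq f g : upi f = upi g <-> U [set t | f t = g t].
Proof.
have E : [set t | f t = g t] = [set t | (f - g) t = 0].
  apply/seteqP; split=> t /=; rewrite (_ : (f - g) t = f t - g t)// => /eqP.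
    by move=> /eqP ->; rewrite subrr.
  by rewrite subr_eq0 => /eqP.
rewrite E; split=> [/eqP|]; rewrite /upi.
  by rewrite eqquotE => /asboolP.
by move=> Ufg; apply/eqP; rewrite eqquotE; apply/asboolP.
Qed.

Lemma upi_is_additive : zmod_morphism upi.
Proof. by move=> f g; rewrite /upi !piE. Qed.

HB.instance Definition _ := GRing.isZmodMorphism.Build _ _ upi upi_is_additive.

Lemma upi_is_multiplicative : monoid_morphism upi.
Proof. by split=> [|f g]; rewrite /upi !piE. Qed.

HB.instance Definition _ := GRing.isMonoidMorphism.Build _ _ upi upi_is_multiplicative.

(** Inverting a representative pointwise is enough: an ultrafilter contains a set or its complement,
    so a nonzero class has a representative that is nonzero on a set of [U]. *)
Definition uinv (x : ultrapower) : ultrapower := upi (fun t => (repr x t)^-1).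

Lemma mulVu x : x != 0 -> uinv x * x = 1.
Proof.
move=> x0; rewrite -{2}[x]reprK -[\pi_ultrapower (repr x)]/(upi (repr x)) -rmorphM -(rmorph1 upi).
apply/upi_eq; have [Ux|] := in_ultra_setVsetC [set t | repr x t = 0] UU.
  case/negP: x0; rewrite -[x]reprK -[\pi_ultrapower (repr x)]/(upi (repr x)) -(rmorph0 upi).
  exact/eqP/upi_eq.
apply: filterS => t /= /eqP xt.
by rewrite /GRing.mul /= mulVf.
Qed.

Lemma uinv0 : uinv 0 = 0.
Proof.
rewrite -[RHS](rmorph0 upi); apply/upi_eq.
have : upi (repr (0 : ultrapower)) = upi 0 by rewrite rmorph0 /upi reprK.
move/upi_eq; apply: filterS => t /= h.
by rewrite h; exact: invr0.
Qed.

HB.instance Definition _ :=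
  GRing.ComNzRing_isField.Build ultrapower mulVu uinv0.

End Ultrapower.

(** * Polynomial functions on the coefficient space in characteristic zero *)

Section PolynomialFunctions.
Variables (C : fieldType) (I : finType).
Hypothesis charC0 : forall n : nat, n.+1%:R != 0 :> C.

Definition poly_fun (P : mpoly.mpoly #|I| C) (c : {ffun I -> C}) : C :=
  mpoly.meval (fun j : 'I_#|I| => c (enum_val j)) P.

Definition line (c v : {ffun I -> C}) (t : C) : {ffun I -> C} :=
  [ffun b => c b + t * v b].

(** Restriction to a line reduces questions on polynomial functions of several variables to one
    variable, where counting roots settles them. *)
Lemma poly_fun_line P c v : exists p : {poly C}, 
  (forall t, p.[t] = poly_fun P (line c v t)) /\
  (forall t, p^`().[t] =
     \sum_i v (enum_val i) * poly_fun (mpoly.mderiv i P) (line c v t)).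
Proof.
pose ok (P : mpoly.mpoly #|I| C) := exists p : {poly C}, 
  (forall t, p.[t] = poly_fun P (line c v t)) /\
  (forall t, p^`().[t] =
     \sum_i v (enum_val i) * poly_fun (mpoly.mderiv i P) (line c v t)).
rewrite -[exists _, _]/(ok P).
have okD P1 P2 : ok P1 -> ok P2 -> ok (P1 + P2).
  move=> [p1 [h1 d1]] [p2 [h2 d2]]; exists (p1 + p2); split=> t.
    by rewrite hornerD h1 h2 /poly_fun mpoly.mevalD.
  rewrite derivD hornerD d1 d2 -big_split; apply: eq_bigr => i _ /=.
  by rewrite mpoly.mderivD /poly_fun mpoly.mevalD mulrDr.
have okM P1 P2 : ok P1 -> ok P2 -> ok (P1 * P2).
  move=> [p1 [h1 d1]] [p2 [h2 d2]]; exists (p1 * p2); split=> t.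
    by rewrite hornerM h1 h2 /poly_fun mpoly.mevalM.
  rewrite derivM hornerD !hornerM h1 d1 h2 d2 mulr_suml mulr_sumr -big_split.
  apply: eq_bigr => i _ /=.
  by rewrite mpoly.mderivM /poly_fun mpoly.mevalD !mpoly.mevalM; ring.
have okC a : ok (mpoly.mpolyC _ a).
  exists a%:P; split=> t; first by rewrite hornerC /poly_fun mpoly.mevalC.
  rewrite derivC horner0 big1// => i _.
  by rewrite mpoly.mderivC /poly_fun mpoly.meval0 mulr0.
have okX i : ok (mpoly.mpolyX C (mpoly.mnm1 i)).
  exists ((c (enum_val i))%:P + v (enum_val i) *: 'X); split=> t.
    by rewrite /poly_fun mpoly.mevalXU ffunE !hornerE mulrC.
  rewrite derivD derivC derivZ derivX !hornerE (bigD1 i)//=.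
  rewrite mpoly.mderivX mpoly.mnm1E eqxx scale1r /poly_fun.
  rewrite (_ : mpoly.mnm_sub _ _ = mpoly.mnm0) ?mpoly.mpolyX0 ?mpoly.meval1 ?mulr1.
    rewrite big1 ?addr0// => j ji; rewrite mpoly.mderivX mpoly.mnm1E eq_sym (negPf ji).
    by rewrite scale0r mpoly.meval0 mulr0.
  by apply/mpoly.mnmP => j; rewrite mpoly.mnmBE subnn mpoly.mnm0E.
elim/mpoly.mpolyind: P => [|a m P _ _ okP].
  by have := okC 0; rewrite mpoly.mpolyC0.
apply: okD => //; rewrite -mpoly.mul_mpolyC; apply: (okM) => //.
rewrite mpoly.mpolyXE_id; apply: (big_ind ok) => [||i _].
- exact: okC.
- exact: okM.
- elim: (m i) => [|k IHk]; first by rewrite expr0; exact: okC.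
  by rewrite exprS; exact: okM.
Qed.

Lemma poly_eq0_fun (p : {poly C}) : (forall t, p.[t] = 0) -> p = 0.
Proof.
move=> p0; apply/eqP; apply: contraT => pN0.
pose s := [seq (i%:R : C) | i <- iota 0 (size p)].
have : (size s < size p)%N.
  apply: max_poly_roots => //; first by apply/allP => x _; apply/rootP.
  rewrite map_inj_in_uniq ?iota_uniq// => i j _ _.
  have lt_inj (k l : nat) : (k < l)%N -> k%:R = l%:R :> C -> False.
    move=> kl /esym/eqP; rewrite -subr_eq0 -natrB ?(ltnW kl)//.
    by case: (l - k)%N (subn_gt0 k l) => [|d]; rewrite ?kl// (negPf (charC0 d)).
  by move=> ij; case: (ltngtP i j) => // /lt_inj; [move/(_ ij)|move/(_ (esym ij))].
by rewrite size_map size_iota ltnn.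
Qed.

(** Differentiate along the coordinate line through [c]. This makes partial derivatives well defined
    on polynomial functions, as the third clause of [derivation_along] will require. *)
Lemma poly_fun_mderiv P i : (forall c, poly_fun P c = 0) ->
  forall c, poly_fun (mpoly.mderiv i P) c = 0.
Proof.
move=> P0 c; pose v : {ffun I -> C} := [ffun b => (b == enum_val i)%:R].
have [p [hp dp]] := poly_fun_line P c v.
have p0 : p = 0 by apply: poly_eq0_fun => t; rewrite hp.
have := dp 0; rewrite p0 deriv0 horner0 (bigD1 i)//= big1 => [|j ji].
  rewrite addr0 ffunE eqxx mul1r => h; rewrite [RHS]h; congr poly_fun.
  by apply/ffunP => b; rewrite ffunE mul0r addr0.
by rewrite ffunE (inj_eq enum_val_inj) (negPf ji) mul0r.
Qed.

Lemma poly_funM P Q c : poly_fun (P * Q) c = poly_fun P c * poly_fun Q c.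
Proof. exact: mpoly.mevalM. Qed.

(** Join a point where [P] is nonzero to one where [Q] is nonzero: on that line both become nonzero
    polynomials in one variable, and so does their product. *)
Lemma poly_fun_integral P Q : (exists c, poly_fun P c != 0) ->
  (exists c, poly_fun Q c != 0) -> exists c, poly_fun (P * Q) c != 0.
Proof.
move=> [c Pc] [d Qd]; pose v := [ffun b => d b - c b].
have [p [hp _]] := poly_fun_line P c v; have [q [hq _]] := poly_fun_line Q c v.
have c0 : line c v 0 = c by apply/ffunP => b; rewrite ffunE mul0r addr0.
have d1 : line c v 1 = d by apply/ffunP => b; rewrite !ffunE mul1r addrC subrK.
apply: contrapT => PQ0.
have : p * q = 0.
  apply: poly_eq0_fun => t; rewrite hornerM hp hq -poly_funM.
  by apply/eqP; apply: contraPT PQ0 => h; apply; exists (line c v t).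
move=> /eqP; rewrite mulf_eq0 => /orP[] /eqP h.
  by case/negP: Pc; rewrite -c0 -hp h horner0.
by case/negP: Qd; rewrite -d1 -hq h horner0.
Qed.

End PolynomialFunctions.

Section UltrapowerFunctions.
Variables (T : pointedType) (C : fieldType) (U : set_system T).
Variable UU : UltraFilter U.

Lemma upi_sum (I : Type) (r : seq I) (f : I -> T -> C) :
  upi UU (fun t => \sum_(i <- r) f i t) = \sum_(i <- r) upi UU (f i).
Proof.
by rewrite -rmorph_sum; congr upi; apply/funext => t; rewrite fct_sumE.
Qed.

Lemma upi_prod (I : Type) (r : seq I) (f : I -> T -> C) :
  upi UU (fun t => \prod_(i <- r) f i t) = \prod_(i <- r) upi UU (f i).
Proof.
by rewrite -rmorph_prod; congr upi; apply/funext => t; rewrite fct_prodE.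
Qed.

Lemma upi_mul (f g : T -> C) : upi UU (fun t => f t * g t) = upi UU f * upi UU g.
Proof. by rewrite -rmorphM. Qed.

Lemma upi_eq0 (f : T -> C) : upi UU f = 0 <-> U [set t | f t = 0].
Proof. by rewrite -(rmorph0 (upi UU)); exact: upi_eq. Qed.

Lemma upi_exprz (f : T -> C) (z : int) : (forall t, f t != 0) ->
  upi UU (fun t => f t ^ z) = upi UU f ^ z.
Proof.
move=> f0; have fX (m : nat) : upi UU (fun t => f t ^+ m) = upi UU f ^+ m.
  elim: m => [|m IHm]; first by rewrite expr0 -(rmorph1 (upi UU)).
  by rewrite exprS -IHm -upi_mul; congr upi; apply/funext => t; rewrite exprS.
case: z => m; first exact: fX.
have u0 : upi UU f ^+ m.+1 != 0.
  rewrite expf_neq0//; apply/eqP => /upi_eq0 /filter_ex[t /= /eqP].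
  by rewrite (negPf (f0 t)).
apply: (mulIf u0); rewrite NegzE -exprnN mulVf// -fX -upi_mul.
rewrite -[RHS](rmorph1 (upi UU)); congr upi; apply/funext => t.
by rewrite mulVf ?expf_neq0.
Qed.

Lemma upi_intr (z : int) : upi UU (fun=> z%:~R : C) = z%:~R.
Proof.
rewrite -[RHS](rmorph_int (upi UU)) /=.
rewrite (_ : (fun=> z%:~R) = (z%:~R : T -> C))//; apply/funext => t.
have E (m : nat) : (m%:R : T -> C) t = m%:R.
  by elim: m => // m IHm; rewrite -natr1 -[in RHS]natr1 -IHm.
by case: z => m; rewrite /intmul -[in LHS]E.
Qed.

End UltrapowerFunctions.

(** * Independence of differentials for generic coefficients *)

Section GenericNondegeneracy.
Variables (C : fieldType) (I : finType) (n k : nat).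
Hypothesis charC0 : forall m : nat, m.+1%:R != 0 :> C.
Variables (e : I -> 'I_n -> int) (alpha : 'I_k -> I -> C).

(** Logarithmic derivatives x_s d/dx_s keep each monomial and only multiply its coefficient by e(b,
    s); on the torus, passing to them does not affect independence of the differentials. *)
Definition nondegenerate (c : {ffun I -> C}) : Prop :=
  forall x : 'I_n -> C, (forall s, x s != 0) ->
  (forall l, \sum_b c b * alpha l b * \prod_s x s ^ e b s = 0) ->
  forall lam : 'I_k -> C,
  (forall s, \sum_l lam l *
     (\sum_b c b * alpha l b * (e b s)%:~R * \prod_s x s ^ e b s) = 0) ->
  forall l, lam l = 0.

(** A name for the coefficient space to which a base point can be attached: the index set of the
    ultrapower is a pointed type. *)
Definition coefs := {ffun I -> C}.
HB.instance Definition _ := Choice.on coefs.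
HB.instance Definition _ := isPointed.Build coefs [ffun=> 0].

Section UltrapowerPolynomials.
Variables (U : set_system coefs) (UU : UltraFilter U).
Hypothesis U_generic : forall P, (exists c, poly_fun P c != 0 :> C) ->
  U [set c | poly_fun P c != 0].

Definition upoly (P : mpoly.mpoly #|I| C) : ultrapower C UU :=
  upi UU (fun c : coefs => poly_fun P c).

Lemma upoly_is_additive : zmod_morphism upoly.
Proof.
move=> P Q; rewrite /upoly -rmorphB; congr upi; apply/funext => c.
exact: mpoly.mevalB.
Qed.

Lemma upoly_is_multiplicative : monoid_morphism upoly.
Proof.
split; rewrite /upoly.
  by rewrite -[RHS](rmorph1 (upi UU)); congr upi; apply/funext => c; exact: mpoly.meval1.
by move=> P Q; rewrite -upi_mul; congr upi; apply/funext => c; exact: poly_funM.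
Qed.

HB.instance Definition _ := GRing.isZmodMorphism.Build _ _ upoly upoly_is_additive.
HB.instance Definition _ := GRing.isMonoidMorphism.Build _ _ upoly upoly_is_multiplicative.

(** By [U_generic] a polynomial with zero image vanishes as a function, so in the ultrapower the
    coefficients are algebraically independent over [C] and partial derivatives descend to their
    polynomials. *)
Lemma upoly_derivation i :
  derivation_along upoly (fun P => upoly (mpoly.mderiv i P)).
Proof.
split=> [P Q|P Q|P].
- by rewrite mpoly.mderivD rmorphD.
- by rewrite mpoly.mderivM rmorphD !rmorphM /= addrC.
move=> /upi_eq0 P0; apply/upi_eq0.
suff Pz : forall c, poly_fun P c = 0.
  by apply: filterS filterT => c _ /=; exact: poly_fun_mderiv.
move=> c; apply/eqP; apply: contraT => Pc.
have := @U_generic P (ex_intro (fun c => poly_fun P c != 0) c Pc) => /(filterI P0)/filter_ex[d /= [->]].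
by rewrite eqxx.
Qed.

End UltrapowerPolynomials.

Lemma generic_nondegenerate :
  (forall lam : 'I_k -> C, (forall b, \sum_l lam l * alpha l b = 0) ->
     forall l, lam l = 0) ->
  exists P : mpoly.mpoly #|I| C, (exists c, poly_fun P c != 0) /\
    forall c, poly_fun P c != 0 -> nondegenerate c.
Proof.
move=> alpha_free; apply: contrapT => noP.
pose bad : set coefs := [set c | ~ nondegenerate c].
have badP P : (exists c, poly_fun P c != 0) -> exists2 c, bad c & poly_fun P c != 0.
  move=> P0; apply: contrapT => nbad; apply: noP; exists P; split=> // c Pc.
  by apply: contrapT => bc; apply: nbad; exists c.
have one_neq0 : exists c : coefs, poly_fun (1 : mpoly.mpoly #|I| C) c != 0.
  by exists point; rewrite /poly_fun mpoly.meval1 oner_neq0.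
(* If no [P] works, the bad coefficients meet the nonvanishing set of every nonzero polynomial; by
   integrality these intersections form the base of a proper filter. *)
pose F : set_system coefs := [set A | exists2 P, exists c : coefs, poly_fun P c != 0 :> C &
  bad `&` [set c | poly_fun P c != 0] `<=` A].
have PF : ProperFilter F.
  split=> [[P /badP[c bc Pc] PA]|]; first exact: (PA c).
  split=> [|A B [P P0 PA] [Q Q0 QB]|A B AB [P P0 PA]].
  - by exists 1.
  - exists (P * Q); first exact: poly_fun_integral.
    move=> c [bc] /=; rewrite poly_funM mulf_eq0 negb_or => /andP[Pc Qc].
    by split; [apply: PA|apply: QB].
  - by exists P => //; exact: subset_trans AB.
have [U [UU FU]] := ultraFilterLemma PF.
have Ubad : U bad by apply: FU; exists 1 => // c [].
have U_generic P : (exists c, poly_fun P c != 0 :> C) -> U [set c | poly_fun P c != 0].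
  by move=> P0; apply: FU; exists P => // c [].
(* [upi_exprz] asks [x] to be nonzero at every [c], not just at the bad ones; good [c] get the
   default x = 1. *)
pose sol (c : coefs) (xl : ('I_n -> C) * ('I_k -> C)) := 
  (forall s, xl.1 s != 0) /\ (bad c ->
  [/\ forall l, \sum_b c b * alpha l b * \prod_s xl.1 s ^ e b s = 0,
      forall s, \sum_l xl.2 l *
        (\sum_b c b * alpha l b * (e b s)%:~R * \prod_s xl.1 s ^ e b s) = 0 &
      exists l, xl.2 l != 0]).
have /choice[xl xlP] c : exists y, sol c y.
  have [bc|nbc] := pselect (bad c); last first.
    by exists (fun=> 1, fun=> 0); split=> // s; exact: oner_neq0.
  move: (bc); rewrite /bad /= /nondegenerate.
  move=> /existsNP[x] /not_implyP[x0] /not_implyP[Fx] /existsNP[lam].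
  move=> /not_implyP[dF] /existsNP[l /eqP lam0].
  by exists (x, lam); split=> // _; split=> //; exists l.
have charL0 m : m.+1%:R != 0 :> ultrapower C UU.
  rewrite -(rmorph_nat (upi UU)); apply/eqP => /upi_eq0/filter_ex[c /=].
  have -> : (m.+1%:R : coefs -> C) c = m.+1%:R by elim: m => // m IHm; rewrite -natr1 -[in RHS]natr1 -IHm.
  by apply/eqP.
pose x s := upi UU (fun c => (xl c).1 s).
pose lam l := upi UU (fun c => (xl c).2 l).
pose X b : mpoly.mpoly #|I| C := mpoly.mpolyX C (mpoly.mnm1 (enum_rank b)).
have upX b : upoly UU (X b) = upi UU (fun c : coefs => c b).
  by congr upi; apply/funext => c; rewrite /poly_fun mpoly.mevalXU enum_rankK.
have upA l b : upoly UU (mpoly.mpolyC #|I| (alpha l b)) = upi UU (fun=> alpha l b).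
  by congr upi; apply/funext => c; exact: mpoly.mevalC.
have xX b : \prod_s x s ^ e b s = upi UU (fun c => \prod_s (xl c).1 s ^ e b s).
  rewrite upi_prod; apply: eq_bigr => s _; rewrite upi_exprz// => c.
  by case: (xlP c).
have lam0 b : U [set c : coefs | \sum_l (xl c).2 l * alpha l b = 0].
  apply/(upi_eq0 UU); rewrite upi_sum.
  under eq_bigr => l _ do rewrite upi_mul -upA.
  apply: (critical_combination_eq0 (e := e) (c := X) (b0 := b) (x := x)
            (lam := lam) (alpha := fun l b => mpoly.mpolyC #|I| (alpha l b)) charL0
            (upoly_derivation UU U_generic (enum_rank b))).
  - move=> b'; rewrite /X mpoly.mderivX mpoly.mnm1E (inj_eq enum_rank_inj).
    case: eqP => [->|_]; last by rewrite scale0r rmorph0.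
    rewrite scale1r (_ : mpoly.mnm_sub _ _ = mpoly.mnm0) ?mpoly.mpolyX0 ?rmorph1//.
    by apply/mpoly.mnmP => j; rewrite mpoly.mnmBE subnn mpoly.mnm0E.
  - by move=> l b'; rewrite mpoly.mderivC rmorph0.
  - move=> s; apply/eqP => /upi_eq0/filter_ex[c /= /eqP].
    by case: (xlP c) => /(_ s)/negPf ->.
  - move=> l /=; under eq_bigr => b' _ do rewrite upX upA xX -!upi_mul.
    rewrite -upi_sum; apply/upi_eq0; apply: filterS Ubad => c bc /=.
    by case: (xlP c) => _ /(_ bc)[].
  - move=> s /=.
    under eq_bigr => l _ do under eq_bigr => b' _ do rewrite upX upA xX -upi_intr -!upi_mul.
    under eq_bigr => l _ do rewrite -upi_sum -upi_mul.
    rewrite -upi_sum; apply/upi_eq0; apply: filterS Ubad => c bc /=.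
    by case: (xlP c) => _ /(_ bc)[].
(* There are finitely many [b], so the identities hold together at one bad [c], where [alpha_free]
   over [C] contradicts the nonzero [lam] chosen there. *)
have /filter_ex[c [/= bc lamc]] : U (bad `&` [set c | forall b, \sum_l (xl c).2 l * alpha l b = 0]).
  by apply: filterI => //; exact: filter_forall.
have [_ /(_ bc)[_ _ [l]]] := xlP c.
by rewrite (alpha_free _ lamc) eqxx.
Qed.
End GenericNondegeneracy.

(** * Cauchy's estimate *)

(** Integration is confined to this lemma; below, integrals appear as increments of
    antiderivatives. *)
Lemma continuous_antiderivative (R : realType) (f : R -> R) (a : R) :
  continuous f -> exists F : R -> R, forall x, a < x -> is_derive x 1 F (f x).
Proof.
move=> cf; exists (fun x => \int[lebesgue_measure]_(t in [set` `[a, x]]) (f t))%R.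
move=> x ax; have xx1 : x < x + 1 by rewrite ltrDl.
have int_f : lebesgue_measure.-integrable `[a, x + 1] (EFin \o f).
  apply: continuous_compact_integrable; first exact: segment_compact.
  by apply: continuous_subspaceT.
have [dF F'] := continuous_FTC1_closed xx1 int_f ax (cf x).
move: dF F'; move: (fun x => _) => F dF F'.
by split; [exact: dF|rewrite -derive1E].
Qed.

(** Stands for the bound [eta * (d - c)] on the integral of f - K over [c, d]; the mean value
    theorem suffices. *)
Lemma increment_approx (R : realType) (F f : R -> R) (K eta c d : R) : c <= d ->
  (forall x, c <= x <= d -> is_derive x 1 F (f x)) ->
  (forall x, c <= x <= d -> `|f x - K| <= eta) ->
  `|F d - F c - K * (d - c)| <= eta * (d - c).
Proof.
rewrite le_eqVlt => /predU1P[->|cd] dF fK; first by rewrite !subrr !mulr0 subrr normr0.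
have [x xcd ->] : exists2 x, x \in `]c, d[%R & F d - F c = f x * (d - c).
  apply: MVT => // [x|]; first by rewrite in_itv /= => /andP[cx xd]; apply: dF; rewrite !ltW.
  apply: derivable_within_continuous => x; rewrite in_itv /= => /dF.
  by case.
rewrite -mulrBl normrM (ger0_norm (_ : 0 <= d - c)) ?subr_ge0 ?(ltW cd)//.
apply: ler_wpM2r; first by rewrite subr_ge0 ltW.
by apply: fK; move: xcd; rewrite in_itv /= => /andP[? ?]; rewrite !ltW.
Qed.

(** * Cauchy's integral theorem on rectangles *)

Section Goursat.
Variable R : realType.

(** The increment of [W] over the rectangle [a, b] x [c, d], additive under subdivision for every
    [W]; boundary integrals will be written in this form. *)
Definition second_difference (W : R -> R -> R) (a b c d : R) : R :=
  W b d - W b c - W a d + W a c.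

Lemma second_difference_split W a b c d :
  let p := (a + b) / 2 in let q := (c + d) / 2 in
  second_difference W a b c d =
  second_difference W a p c q + second_difference W p b c q +
  (second_difference W a p q d + second_difference W p b q d).
Proof. by rewrite /second_difference /=; lra. Qed.

(* If the bound fails, it fails on a nested sequence of quarters, contradicting
   the local bound at their common point. *)
Lemma second_difference_small W (w t eta : R) (a c : R) : 0 < w -> 0 < t ->
  (forall x0 y0, a <= x0 <= a + w -> c <= y0 <= c + t ->
   exists2 r, 0 < r & forall a' c' z, 0 < z -> z < r ->
     a <= a' -> a' + z * w <= a + w -> c <= c' -> c' + z * t <= c + t ->
     a' <= x0 <= a' + z * w -> c' <= y0 <= c' + z * t ->
     `|second_difference W a' (a' + z * w) c' (c' + z * t)| <= eta * z ^+ 2) ->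
  `|second_difference W a (a + w) c (c + t)| <= eta.
Proof.
move=> w0 t0 loc; rewrite leNgt; apply/negP => big.
pose h (n : nat) : R := 2 ^- n.
have h0 n : 0 < h n by rewrite invr_gt0 exprn_gt0.
have hS n : h n.+1 = h n / 2 by rewrite /h exprSr invfM.
pose bad n (p : R * R) := [/\ a <= p.1, p.1 + h n * w <= a + w,
  c <= p.2, p.2 + h n * t <= c + t &
  eta * h n ^+ 2 < `|second_difference W p.1 (p.1 + h n * w) p.2 (p.2 + h n * t)|].
have step n p : bad n p -> exists q, bad n.+1 q /\
    (p.1 <= q.1 <= p.1 + h n.+1 * w /\ p.2 <= q.2 <= p.2 + h n.+1 * t).
  case: p => x y [/= ax xw cy yt]; rewrite second_difference_split.
  have hw : 0 < h n.+1 * w by rewrite mulr_gt0.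
  have ht : 0 < h n.+1 * t by rewrite mulr_gt0.
  have ew : h n * w = h n.+1 * w + h n.+1 * w by rewrite hS; lra.
  have et : h n * t = h n.+1 * t + h n.+1 * t by rewrite hS; lra.
  have eh : h n ^+ 2 = h n.+1 ^+ 2 + h n.+1 ^+ 2 + (h n.+1 ^+ 2 + h n.+1 ^+ 2).
    by rewrite hS; field.
  have -> : (x + (x + h n * w)) / 2 = x + h n.+1 * w by rewrite ew; lra.
  have -> : (y + (y + h n * t)) / 2 = y + h n.+1 * t by rewrite et; lra.
  rewrite ew et eh !mulrDr !(addrA x) !(addrA y) in xw yt * => bad4.
  apply: contrapT => nq.
  have small u v : x <= u <= x + h n.+1 * w -> y <= v <= y + h n.+1 * t ->
     `|second_difference W u (u + h n.+1 * w) v (v + h n.+1 * t)| <= eta * h n.+1 ^+ 2.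
    move=> /andP[u1 u2] /andP[v1 v2]; rewrite leNgt; apply/negP => buv; apply: nq.
    exists (u, v); split; last by rewrite /= u1 u2 v1 v2.
    by split=> //=; lra.
  have xx : x <= x <= x + h n.+1 * w by rewrite lexx lerDl ltW.
  have xx' : x <= x + h n.+1 * w <= x + h n.+1 * w by rewrite lexx lerDl ltW.
  have yy : y <= y <= y + h n.+1 * t by rewrite lexx lerDl ltW.
  have yy' : y <= y + h n.+1 * t <= y + h n.+1 * t by rewrite lexx lerDl ltW.
  have s1 := small _ _ xx yy; have s2 := small _ _ xx' yy.
  have s3 := small _ _ xx yy'; have s4 := small _ _ xx' yy'.
  have := lt_le_trans bad4 (le_trans (ler_normD _ _) (lerD (ler_normD _ _) (ler_normD _ _))).
  by rewrite ltNge (lerD (lerD s1 s2) (lerD s3 s4)).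
(* The choice of a bad quarter is made total by a default, so that the sequence can be defined by
   recursion before badness is proved along it. *)
have [p [p0 pS]] : exists p : nat -> R * R, p 0 = (a, c) /\ forall n,
    bad n (p n) -> bad n.+1 (p n.+1) /\ ((p n).1 <= (p n.+1).1 <= (p n).1 + h n.+1 * w /\
      (p n).2 <= (p n.+1).2 <= (p n).2 + h n.+1 * t).
  have /choice[nxt nxtP] (np : nat * (R * R)) : exists q, bad np.1 np.2 -> bad np.1.+1 q /\
      (np.2.1 <= q.1 <= np.2.1 + h np.1.+1 * w /\ np.2.2 <= q.2 <= np.2.2 + h np.1.+1 * t).
    have [/step[q qP]|nb] := pselect (bad np.1 np.2); first by exists q.
    by exists (a, c).
  pose p := fix p n := if n is m.+1 then nxt (m, p m) else (a, c).
  by exists p; split=> // n /(nxtP (n, p n)).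
have pbad n : bad n (p n).
  elim: n => [|n /pS[]//]; rewrite p0 /bad /h /= expr0 invr1 expr1n mulr1 !mul1r.
  by split.
have lim (f : R * R -> R) (s m : R) : f (a, c) = m -> 0 < s ->
    (forall n, f (p n) <= f (p n.+1) <= f (p n) + h n.+1 * s) ->
    exists l, forall n, f (p n) <= l <= f (p n) + h n * s.
  move=> fm s0 fS; pose l := sup (range (f \o p)).
  (* The allowed increments telescope, since [h m.+1 = h m - h m.+1]. *)
  have up k n : f (p (n + k)%N) <= f (p n) + (h n - h (n + k)%N) * s.
    elim: k => [|k IHk]; first by rewrite addn0 subrr mul0r addr0.
    have /andP[_] := fS (n + k)%N; rewrite addnS => /le_trans; apply.
    by rewrite -lerBrDr (le_trans IHk)// lerBrDr hS -addrA lerD2l; lra.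
  have mono k n : f (p n) <= f (p (n + k)%N).
    elim: k => [|k IHk]; first by rewrite addn0.
    by rewrite addnS (le_trans IHk)//; case/andP: (fS (n + k)%N).
  have ub n k : f (p k) <= f (p n) + h n * s.
    have [nk|kn] := leqP n k.
      rewrite -(subnKC nk) (le_trans (up _ _))// lerD2l ler_pM2r// gerBl.
      exact: ltW.
    by rewrite -(subnKC (ltnW kn)) (le_trans (mono (n - k)%N k))// lerDl mulr_ge0// ltW.
  exists l => n; apply/andP; split.
    apply: ub_le_sup; last by exists n.
    by exists (f (p 0%N) + h 0%N * s) => _ [k _ <-]; exact: ub.
  apply: ge_sup; first by exists (f (p 0%N)), 0%N.
  by move=> _ [k _ <-]; exact: ub.
have [x0 x0P] := lim fst w a erefl w0 (fun n => (pS n (pbad n)).2.1).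
have [y0 y0P] := lim snd t c erefl t0 (fun n => (pS n (pbad n)).2.2).
have [r r0 rP] : exists2 r, 0 < r & forall a' c' z, 0 < z -> z < r ->
     a <= a' -> a' + z * w <= a + w -> c <= c' -> c' + z * t <= c + t ->
     a' <= x0 <= a' + z * w -> c' <= y0 <= c' + z * t ->
     `|second_difference W a' (a' + z * w) c' (c' + z * t)| <= eta * z ^+ 2.
  by apply: loc; [have := x0P 0%N|have := y0P 0%N]; rewrite p0 /h /= expr0 invr1 mul1r.
have [n hn] : exists n, h n < r.
  have [n _ /(_ n (leqnn n)) hn] := near_infty_natSinv_expn_lt (PosNum r0).
  by exists n; move: hn; rewrite /h /= div1r.
have [b1 b2 b3 b4] := pbad n; rewrite ltNge => /negP; apply.
by apply: rP.
Qed.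
End Goursat.

Section Cylinder.
Variable R : realType.
Implicit Types u v : R -> R -> R.

(** Complex differentiability of u + iv at x0 + i y0 with derivative be + i ga, relative to the
    closed half-plane x <= 0, the only region where the functions are controlled. *)
Definition cauchy_riemann u v (x0 y0 : R) : Prop :=
  exists be ga : R, forall e, 0 < e -> exists2 r, 0 < r & forall x y, x <= 0 ->
    `|x - x0| < r -> `|y - y0| < r ->
    `|u x y - (u x0 y0 + be * (x - x0) - ga * (y - y0))| <= e * (`|x - x0| + `|y - y0|) /\
    `|v x y - (v x0 y0 + ga * (x - x0) + be * (y - y0))| <= e * (`|x - x0| + `|y - y0|).


(** Multiplication by -i; it transfers results on the first component to the second. *)
Lemma cauchy_riemann_swap u v x0 y0 :
  cauchy_riemann u v x0 y0 -> cauchy_riemann v (fun x y => - u x y) x0 y0.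
Proof.
move=> [be [ga cr]]; exists ga, (- be) => e /cr[r r0 rP]; exists r => // x y xx xr yr.
have [h1 h2] := rP _ _ xx xr yr; split.
  by apply: le_trans h2; rewrite mulNr opprK.
apply: le_trans h1; rewrite -normrN le_eqVlt; apply/orP; left; apply/eqP.
by congr `|_|; ring.
Qed.

Lemma cauchy_riemann_continuous u v x0 y0 : cauchy_riemann u v x0 y0 ->
  forall e, 0 < e -> exists2 r, 0 < r & forall x y, x <= 0 ->
    `|x - x0| < r -> `|y - y0| < r -> `|u x y - u x0 y0| <= e.
Proof.
move=> [be [ga cr]] e e0; have [r r0 rP] := cr 1 ltr01.
pose k := `|be| + `|ga| + 2.
have k0 : 0 < k by rewrite ltr_wpDl// addr_ge0.
exists (Num.min r (e / k)); first by rewrite lt_min r0 divr_gt0.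
move=> x y xx; rewrite !lt_min => /andP[xr xe] /andP[yr ye].
have [+ _] := rP _ _ xx xr yr; rewrite mul1r => h.
have ek : e = k * (e / k) by rewrite mulrC divfK ?gt_eqF.
have -> : u x y - u x0 y0 = (u x y - (u x0 y0 + be * (x - x0) - ga * (y - y0))) +
  (be * (x - x0) - ga * (y - y0)) by ring.
rewrite (le_trans (ler_normD _ _))//.
have h2 : `|be * (x - x0) - ga * (y - y0)| <= `|be| * `|x - x0| + `|ga| * `|y - y0|.
  by rewrite (le_trans (ler_normB _ _))// !normrM.
rewrite (le_trans (lerD h h2))// ek /k.
have b1 : `|be| * `|x - x0| <= `|be| * (e / k) by rewrite ler_wpM2l// ltW.
have g1 : `|ga| * `|y - y0| <= `|ga| * (e / k) by rewrite ler_wpM2l// ltW.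
move: (ltW xe) (ltW ye) b1 g1; rewrite -/k; move: (e / k) (`|be| * _) (`|ga| * _) => q.
by clear; move=> p1 p2; rewrite !mulrDl; lra.
Qed.

(** This second difference is the integral of v dx + u dy around the rectangle, the imaginary part
    of that of (u + iv) dz. On a small rectangle the linear parts of [u] and [v] contribute the same
    term be (b' - a')(d' - c') to [V] and to [U]; it cancels and only the approximation error
    remains. *)
Lemma goursat u v (V U : R -> R -> R) (a T : R) : a < 0 -> 0 < T ->
  (forall x y, x <= 0 -> cauchy_riemann u v x y) ->
  (forall x y : R, x <= 0 -> 0 <= y -> is_derive y 1 (V x) (u x y)) ->
  (forall x y : R, a <= x -> x <= 0 -> is_derive x 1 (U y) (v x y)) ->
  second_difference (fun x y => V x y - U y x) a 0 0 T = 0.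
Proof.
move=> a0 T0 cr dV dU; apply/eqP; rewrite -normr_eq0 eq_le normr_ge0 andbT.
apply/ler_addgt0Pr => eta eta0; rewrite add0r.
pose w := - a; have w0 : 0 < w by rewrite oppr_gt0.
have aw : a + w = 0 by rewrite subrr.
have := @second_difference_small R (fun x y => V x y - U y x) w T eta a 0 w0 T0.
rewrite aw add0r; apply => x0 y0 /andP[ax0 x00] /andP[y0ge y0T].
have [be [ga crP]] := cr x0 y0 x00.
(* On a rectangle with sides z w and z T the two errors add up to 2 e (z s)^2, which is eta z^2 for
   this [e]. *)
pose s := w + T; have s0 : 0 < s by rewrite addr_gt0.
pose e := eta / (2 * s ^+ 2); have e0 : 0 < e by rewrite divr_gt0// mulr_gt0// exprn_gt0.
have [r r0 rP] := crP e e0.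
exists (r / s); first by rewrite divr_gt0.
move=> a' c' z z0 zr aa' a'w cc' c'T /andP[a'x xb'] /andP[c'y yd'].
set b' := a' + z * w in a'w xb' *; set d' := c' + z * T in c'T yd' *.
have zs : z * s < r by rewrite -ltr_pdivlMr.
have zw0 : 0 < z * w by rewrite mulr_gt0.
have zT0 : 0 < z * T by rewrite mulr_gt0.
have zsE : z * s = z * w + z * T by rewrite mulrDr.
have xnear x : a' <= x <= b' -> `|x - x0| <= z * w.
  by move=> /andP[]; rewrite ler_norml /b' in xb' *; move: xb' a'x; clear; lra.
have ynear y : c' <= y <= d' -> `|y - y0| <= z * T.
  by move=> /andP[]; rewrite ler_norml /d' in yd' *; move: yd' c'y; clear; lra.
have near x y : a' <= x <= b' -> c' <= y <= d' ->
    `|u x y - (u x0 y0 + be * (x - x0) - ga * (y - y0))| <= e * (z * s) /\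
    `|v x y - (v x0 y0 + ga * (x - x0) + be * (y - y0))| <= e * (z * s).
  move=> xab ycd; have hx := xnear _ xab; have hy := ynear _ ycd.
  have [|||h1 h2] := rP x y.
  - by case/andP: xab => _ /le_trans; apply.
  - by rewrite (le_lt_trans hx)// (le_lt_trans _ zs)// zsE lerDl ltW.
  - by rewrite (le_lt_trans hy)// (le_lt_trans _ zs)// zsE lerDr ltW.
  have le_s : e * (`|x - x0| + `|y - y0|) <= e * (z * s).
    by rewrite ler_pM2l// zsE lerD.
  by split; [exact: le_trans h1 le_s|exact: le_trans h2 le_s].
have ab' : a' <= b' by rewrite lerDl ltW.
have cd' : c' <= d' by rewrite lerDl ltW.
have aab : a' <= a' <= b' by rewrite lexx.
have bab : a' <= b' <= b' by rewrite lexx andbT.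
have ccd : c' <= c' <= d' by rewrite lexx.
have dcd : c' <= d' <= d' by rewrite lexx andbT.
have a'0 : a' <= 0 by rewrite (le_trans ab').
have Vinc : `|(V b' d' - V a' d') - (V b' c' - V a' c') - be * (b' - a') * (d' - c')|
    <= 2 * (e * (z * s)) * (d' - c').
  apply: (@increment_approx R (fun y => V b' y - V a' y) (fun y => u b' y - u a' y)) => //.
    move=> y /andP[cy _]; have y0' : 0 <= y by rewrite (le_trans cc').
    have ? := dV b' y a'w y0'; have ? := dV a' y a'0 y0'.
    exact: is_deriveB.
  move=> y ycd; have [h1 _] := near _ _ bab ycd; have [h2 _] := near _ _ aab ycd.
  have -> : u b' y - u a' y - be * (b' - a') =
    (u b' y - (u x0 y0 + be * (b' - x0) - ga * (y - y0))) -
    (u a' y - (u x0 y0 + be * (a' - x0) - ga * (y - y0))) by ring.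
  by rewrite (le_trans (ler_normB _ _))// mulr_natl mulr2n lerD.
have Uinc : `|(U d' b' - U c' b') - (U d' a' - U c' a') - be * (d' - c') * (b' - a')|
    <= 2 * (e * (z * s)) * (b' - a').
  apply: (@increment_approx R (fun x => U d' x - U c' x) (fun x => v x d' - v x c')) => //.
    move=> x /andP[ax xb]; have ax' : a <= x by rewrite (le_trans aa').
    have x0' : x <= 0 by rewrite (le_trans xb).
    have ? := dU x d' ax' x0'; have ? := dU x c' ax' x0'.
    exact: is_deriveB.
  move=> x xab; have [_ h1] := near _ _ xab dcd; have [_ h2] := near _ _ xab ccd.
  have -> : v x d' - v x c' - be * (d' - c') =
    (v x d' - (v x0 y0 + ga * (x - x0) + be * (d' - y0))) -
    (v x c' - (v x0 y0 + ga * (x - x0) + be * (c' - y0))) by ring.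
  by rewrite (le_trans (ler_normB _ _))// mulr_natl mulr2n lerD.
rewrite /second_difference.
have -> : V b' d' - U d' b' - (V b' c' - U c' b') - (V a' d' - U d' a') + (V a' c' - U c' a') =
  ((V b' d' - V a' d') - (V b' c' - V a' c') - be * (b' - a') * (d' - c')) -
  ((U d' b' - U c' b') - (U d' a' - U c' a') - be * (d' - c') * (b' - a')) by ring.
rewrite (le_trans (ler_normB _ _))// (le_trans (lerD Vinc Uinc))//.
rewrite -mulrDr (_ : d' - c' + (b' - a') = z * s); last by rewrite /d' /b' zsE; ring.
rewrite (_ : _ * (z * s) = eta * z ^+ 2)// /e; field.
by rewrite gt_eqF.
Qed.
End Cylinder.

(** Apply the integral theorem on [a, 0] x [0, T]. The horizontal sides cancel by periodicity of
    [v], so [u] has equal means over the sides x = 0 and x = a; the first is at most [M] and the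
    second is within [e] of [A]. *)
Lemma cylinder_bound (R : realType) (u v : R -> R -> R) (T A M : R) : 0 < T ->
  (forall x y : R, x <= 0 -> cauchy_riemann u v x y) ->
  (forall x : R, x <= 0 -> v x T = v x 0) -> (forall y, `|u 0 y| <= M) ->
  (forall e : R, 0 < e -> exists2 x : R, x < 0 & forall y, `|u x y - A| <= e) ->
  A <= M.
Proof.
move=> T0 cr vT uM uA; apply/ler_addgt0Pr => e e0.
have [a a0 uaA] := uA e e0.
have N10 : -1 < 0 :> R by rewrite ltrN10.
have a10 : a - 1 < a by rewrite gtrBl.
(* Starting the antiderivative at -1 makes y = 0 an interior point, so that [V x] has a two-sided
   derivative there. *)
have /choice[V VP] (x : R) : exists F : R -> R, x <= 0 -> forall y : R, -1 < y -> is_derive y 1 F (u x y).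
  have [x0|_] := boolP (x <= 0); last by exists (u x).
  have [F FP] : exists F : R -> R, forall y : R, -1 < y -> is_derive y 1 F (u x y).
    apply: continuous_antiderivative => y; apply/cvgrPdist_le => eps eps0.
    have [r r0 rP] := cauchy_riemann_continuous (cr x y x0) eps0.
    apply/nbhs_ballP; exists r => //= t; rewrite /ball /= distrC => tr.
    by rewrite distrC rP ?subrr ?normr0.
  by exists F.
(* [v] is controlled for x <= 0 only; replacing x by min(x, 0) gives a function continuous on the
   whole line that agrees with [v] where it is used. *)
have clamp (x t : R) : `|Num.min t 0 - Num.min x 0| <= `|t - x|.
  by rewrite /Num.min; case: ifP => ht; case: ifP => hx; rewrite ?subrr ?normr0//;
    rewrite ler_norml; apply/andP; split; move: ht hx; case: (ger0P (t - x)); lra.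
have /choice[U UP] (y : R) : exists F : R -> R, forall x : R, a - 1 < x -> is_derive x 1 F (v (Num.min x 0) y).
  apply: continuous_antiderivative => x; apply/cvgrPdist_le => eps eps0.
  have x0 : Num.min x 0 <= 0 by rewrite ge_min lexx orbT.
  have := cauchy_riemann_swap (cr _ y x0).
  move=> /cauchy_riemann_continuous/(_ _ eps0)[r r0 rP].
  apply/nbhs_ballP; exists r => //= t; rewrite /ball /= distrC => tr.
  rewrite distrC rP ?subrr ?normr0 ?ge_min ?lexx ?orbT//.
  exact: le_lt_trans (clamp _ _) tr.
have dV (x y : R) : x <= 0 -> 0 <= y -> is_derive y 1 (V x) (u x y).
  by move=> x0 y0; apply: VP => //; rewrite (lt_le_trans N10).
have dU (x y : R) : a <= x -> x <= 0 -> is_derive x 1 (U y) (v x y).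
  by move=> ax x0; have := UP y x (lt_le_trans a10 ax); rewrite min_l.
have := goursat a0 T0 cr dV dU; rewrite /second_difference => W0.
have UT : `|(U T 0 - U 0 0) - (U T a - U 0 a) - 0 * (0 - a)| <= 0 * (0 - a).
  apply: (@increment_approx R (fun x => U T x - U 0 x) (fun x => v x T - v x 0)).
  - exact: ltW.
  - move=> x /andP[ax x0]; have ? := dU x T ax x0; have ? := dU x 0 ax x0.
    exact: is_deriveB.
  - by move=> x /andP[_ x0]; rewrite vT// subrr subr0 normr0.
have V0 : `|V 0 T - V 0 0 - 0 * (T - 0)| <= M * (T - 0).
  apply: (@increment_approx R (V 0) (u 0)); first exact: ltW.
    by move=> y /andP[y0 _]; exact: dV.
  by move=> y _; rewrite subr0.
have Va : `|V a T - V a 0 - A * (T - 0)| <= e * (T - 0).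
  apply: (@increment_approx R (V a) (u a)) => //; first exact: ltW.
  by move=> y /andP[y0 _]; apply: dV => //; exact: ltW.
move: UT V0 Va; rewrite !mul0r !subr0 normr_le0 => /eqP UT.
rewrite !ler_norml => /andP[_ V0] /andP[Va _].
rewrite -(ler_pM2r T0); move: W0 UT V0 Va; clear.
by move: (V 0 T) (V 0 0) (V a T) (V a 0) (U T 0) (U 0 0) (U T a) (U 0 a) => *; lra.
Qed.

(** * The complex exponential and complex differentiability in real terms *)

Section ComplexAux.
Variable R : realType.
Local Notation C := R[i].
Local Open Scope complex_scope.
Local Notation Re := complex.Re.
Local Notation Im := complex.Im.

Lemma normc_real (x : R) : `|x%:C| = `|x|%:C :> C.
Proof. by rewrite normc_def /= expr0n /= addr0 sqrtr_sqr. Qed.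

Lemma normc_Re_Im_le (z : C) : `|z| <= (`|Re z| + `|Im z|)%:C.
Proof.
have i1 : `|'i%C| = 1 :> C by rewrite normc_def /= expr0n /= add0r expr1n sqrtr1.
rewrite {1}(complexE z) (le_trans (ler_normD _ _))// normrM i1 mul1r !normc_real.
by rewrite rmorphD.
Qed.

Lemma Re_le_normc (z : C) : `|Re z|%:C <= `|z|.
Proof. exact: normc_ge_Re. Qed.

Lemma Im_le_normc (z : C) : `|Im z|%:C <= `|z|.
Proof.
rewrite normc_def lecR -sqrtr_sqr ler_sqrt ?addr_ge0 ?sqr_ge0//.
by rewrite lerDr sqr_ge0.
Qed.

Lemma gt0_complex (e : C) : 0 < e -> exists2 r : R, 0 < r & e = r%:C.
Proof. by case: e => a b; rewrite ltcE /= => /andP[/eqP -> a0]; exists a. Qed.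

Definition cexp (z : C) : C := (expR (Re z))%:C * (cos (Im z) +i* sin (Im z)).

Lemma cexpD z w : cexp (z + w) = cexp z * cexp w.
Proof.
case: z w => [a b] [c d]; rewrite /cexp /= expRD cosD sinD.
by apply/eqP; rewrite eq_complex /= !mul0r !subr0 !addr0; apply/andP; split; apply/eqP; ring.
Qed.

Lemma norm_cexp z : `|cexp z| = (expR (Re z))%:C.
Proof.
rewrite /cexp normrM normc_real [X in _ * X]normc_def /= cos2Dsin2 sqrtr1 mulr1.
by rewrite ger0_norm ?expR_ge0.
Qed.

Lemma is_derive_eps (f : R -> R) (x df : R) : is_derive x 1 f df ->
  forall e, 0 < e -> exists2 r, 0 < r & forall t, `|t| < r ->
    `|f (x + t) - f x - df * t| <= e * `|t|.
Proof.
move=> [dx <-] e e0.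
have /cvgrPdist_le/(_ e e0)/nbhs_ballP[r /= r0 rP] := dx.
exists r => // t tr; have [->|t0] := eqVneq t 0.
  by rewrite addr0 subrr mulr0 subrr normr0 mulr0.
have := rP t; rewrite /ball /= sub0r normrN => /(_ tr t0).
rewrite -(ler_pM2r (_ : 0 < `|t|)) ?normr_gt0// -normrM => /(le_trans _); apply.
rewrite -normrN le_eqVlt; apply/orP; left; apply/eqP; congr `|_|.
by rewrite -['D_1 f x]/(lim _) /GRing.scale /= mulr1 (addrC t) mulrBl mulrAC mulVf// mul1r; ring.
Qed.

Lemma cexp_eps (e : R) : 0 < e -> exists2 r, 0 < r & forall w : C, `|w| < r%:C ->
  `|cexp w - 1 - w| <= e%:C * `|w|.
Proof.
(* d <= 1 bounds expR x by 2 and |sin y| by 2 |y|; the errors then sum to at most d |x| + 5 d |y|,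
   hence the 6. *)
move=> e0; pose d := Num.min 1 (e / 6).
have d0 : 0 < d by rewrite lt_min ltr01 divr_gt0.
have d1 : d <= 1 by rewrite ge_min lexx.
have de : 6 * d <= e by rewrite mulrC -ler_pdivlMr// ge_min lexx orbT.
have [r1 r10 E1] := is_derive_eps (is_derive_expR (0 : R)) d0.
have [r2 r20 E2] := is_derive_eps (is_derive_cos (0 : R)) d0.
have [r3 r30 E3] := is_derive_eps (is_derive_sin (0 : R)) d0.
exists (Num.min (d / 2) (Num.min r1 (Num.min r2 r3))).
  by rewrite !lt_min r10 r20 r30 divr_gt0.
move=> w wr; have Rw := le_lt_trans (Re_le_normc w) wr.
have Iw := le_lt_trans (Im_le_normc w) wr.
move: Rw Iw; rewrite !ltcR !lt_min => /and4P[xd xr1 xr2 xr3] /and4P[yd yr1 yr2 yr3].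
have wE : `|Re w|%:C <= `|w| /\ `|Im w|%:C <= `|w| := conj (Re_le_normc w) (Im_le_normc w).
case: w wE xd xr1 xr2 xr3 yd yr1 yr2 yr3 {wr} => x y /= [Rw Iw] xd xr1 xr2 xr3 yd yr1 yr2 yr3.
have := E1 x xr1; rewrite add0r expR0 mul1r => e1.
have := E2 y yr2; rewrite add0r cos0 sin0 oppr0 mul0r subr0 => e2.
have := E3 y yr3; rewrite add0r cos0 sin0 mul1r subr0 => e3.
rewrite (le_trans (normc_Re_Im_le _))// /cexp /= !mul0r subr0 addr0 oppr0 !addr0.
have expd : `|expR x - 1| <= d.
  have -> : expR x - 1 = (expR x - 1 - x) + x by ring.
  rewrite (le_trans (ler_normD _ _))// (splitr d) lerD ?(ltW xd)//.
  by rewrite (le_trans e1)// (le_trans _ (ltW xd))// ler_piMl.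
have re : `|expR x * cos y - 1 - x| <= d * `|x| + 2 * (d * `|y|).
  have -> : expR x * cos y - 1 - x = (expR x - 1 - x) + expR x * (cos y - 1) by ring.
  rewrite (le_trans (ler_normD _ _))// lerD// normrM ler_pM//.
  have -> : expR x = (expR x - 1) + 1 by ring.
  rewrite (le_trans (ler_normD _ _))// normr1 -[leRHS]/(1 + 1) lerD2r.
  exact: le_trans d1.
have im : `|expR x * sin y - y| <= 3 * (d * `|y|).
  have -> : expR x * sin y - y = (expR x - 1) * sin y + (sin y - y) by ring.
  have siny : `|sin y| <= 2 * `|y|.
    have -> : sin y = (sin y - y) + y by ring.
    rewrite (le_trans (ler_normD _ _))// mulr_natl mulr2n lerD//.
    by rewrite (le_trans e3)// ler_piMl.
  rewrite (le_trans (ler_normD _ _))// normrM.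
  have -> : 3 * (d * `|y|) = d * (2 * `|y|) + d * `|y| by ring.
  by rewrite lerD// ler_pM.
apply: (@le_trans _ _ (d * `|x| + 5 * (d * `|y|))%:C).
  rewrite lecR (le_trans (lerD re im))// le_eqVlt; apply/orP; left; apply/eqP.
  by ring.
rewrite (@le_trans _ _ ((6 * d)%:C * `|x +i* y|))//; last first.
  by rewrite ler_wpM2r ?normr_ge0// lecR.
rewrite rmorphD !rmorphM /=.
have d0' : 0 <= d%:C :> C by rewrite ler0c ltW.
have h1 := ler_wpM2l d0' Rw; have h2 := ler_wpM2l d0' Iw.
have -> : 6%:C * d%:C * `|x +i* y| = d%:C * `|x +i* y| + 5%:C * (d%:C * `|x +i* y|).
  rewrite (_ : 6%:C = 1 + 5%:C); last by rewrite -(rmorph1 (real_complex R)) -rmorphD; congr (_%:C); ring.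
  by ring.
by rewrite lerD// ler_wpM2l// ler0c ler0n.
Qed.

Lemma ball_complex (z : C^o) (P : set C^o) : (\forall w \near z, P w) <->
  exists2 r : R, 0 < r & forall w, `|w| < r%:C -> P (z + w).
Proof.
split=> [/nbhs_ballP[r /= /gt0_complex[r' r'0 ->] rP]|[r r0 rP]].
  exists r' => // w wr; apply: rP; rewrite /ball /= opprD addNKr normrN.
  exact: wr.
apply/nbhs_ballP; exists r%:C => /=; first by rewrite ltcR.
by move=> w; rewrite /ball /= distrC => /rP; rewrite addrC subrK.
Qed.

Lemma cexp_differentiable (z : C^o) : differentiable (cexp : C^o -> C^o) z.
Proof.
apply/derivable1_diffP; apply/cvg_ex; exists (cexp z : C^o).
apply/cvgrPdist_le => _ /gt0_complex[e e0 ->].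
have ez : 0 < e / expR (Re z) by rewrite divr_gt0 ?expR_gt0.
have [r r0 rP] := cexp_eps ez.
apply/(@ball_complex 0); exists r => // w /rP; rewrite add0r => wP w0.
rewrite /GRing.scale /= mulr1 [_ + z]addrC cexpD.
have -> : cexp z - w^-1 * (cexp z * cexp w - cexp z) =
    - (cexp z * (w^-1 * (cexp w - 1 - w))) by field.
rewrite normrN normrM norm_cexp normrM normfV mulrCA ler_pdivrMl ?normr_gt0// mulrC.
rewrite (le_trans (ler_wpM2r _ wP)) ?ler0c ?expR_ge0//.
by rewrite mulrAC -(rmorphM (real_complex R)) /= divfK ?gt_eqF ?expR_gt0// mulrC.
Qed.

Lemma differentiable_eps (K : numFieldType) (V W : normedModType K) (f : V -> W) x :
  differentiable f x -> forall e, 0 < e ->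
  \forall h \near 0, `|f (x + h) - f x - 'd f x h| <= e * `|h|.
Proof.
move=> /diff_locally/eqaddoP df e e0; have := df e e0.
apply: filterS => h; rewrite -addrA -opprD [x + h]addrC; exact.
Qed.

Lemma differentiable_complex_eps (f : C^o -> C^o) (z : C^o) : differentiable f z ->
  forall e, 0 < e -> exists2 r, 0 < r & forall w : C, `|w| < r%:C ->
  `|f (z + w) - f z - w * 'd f z 1| <= e%:C * `|w|.
Proof.
move=> df e e0; have e0' : 0 < e%:C :> C by rewrite ltcR.
have /(@ball_complex 0)[r r0 rP] := differentiable_eps df e0'.
exists r => // w /rP; rewrite add0r.
suff -> : 'd f z w = w * 'd f z 1 by [].
by rewrite -[in LHS](mulr1 w) -[w * 1]/(w *: (1 : C^o)) linearZ.
Qed.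

Lemma complex_cauchy_riemann (H : C^o -> C^o) (x0 y0 : R) :
  differentiable H (x0 +i* y0 : C^o) ->
  cauchy_riemann (fun x y => Re (H (x +i* y))) (fun x y => Im (H (x +i* y))) x0 y0.
Proof.
move=> dH; pose a := 'd H (x0 +i* y0 : C^o) 1; exists (Re a), (Im a) => e e0.
have [r r0 rP] := differentiable_complex_eps dH e0.
exists (r / 2); first by rewrite divr_gt0.
move=> x y _ xr yr; pose w : C := (x - x0) +i* (y - y0).
have wle : `|w| <= (`|x - x0| + `|y - y0|)%:C := normc_Re_Im_le w.
have wr : `|w| < r%:C by rewrite (le_lt_trans wle)// ltcR (splitr r) ltrD.
have := rP _ wr; have -> : (x0 +i* y0 : C^o) + w = x +i* y.
  by apply/eqP; rewrite eq_complex /= !(addrC x0) !(addrC y0) !subrK !eqxx.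
move=> /le_trans/(_ (ler_wpM2l _ wle)) h.
have {}h : `|H (x +i* y) - H (x0 +i* y0) - w * a| <= (e * (`|x - x0| + `|y - y0|))%:C.
  by rewrite rmorphM; apply: h; rewrite ler0c ltW.
have hR := le_trans (Re_le_normc _) h; have hI := le_trans (Im_le_normc _) h.
move: hR hI; rewrite !lecR /w -/a.
case: (H (x +i* y)) => h1 h2; case: (H (x0 +i* y0)) => k1 k2; case: (a) => be ga /= hR hI.
split; [apply: le_trans hR|apply: le_trans hI].
  by rewrite le_eqVlt; apply/orP; left; apply/eqP; congr `|_|; ring.
by rewrite le_eqVlt; apply/orP; left; apply/eqP; congr `|_|; ring.
Qed.

End ComplexAux.

Section CauchyEstimate.
Variable R : realType.
Local Notation C := R[i].
Local Open Scope complex_scope.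
Local Notation Re := complex.Re.
Local Notation Im := complex.Im.

(* In the coordinate w with z = rho e^w the quotient (h z - h 0) / z is
   periodic in Im w and tends to the derivative as Re w tends to -oo. *)
Lemma cauchy_estimate (h : C^o -> C^o) (a : C) (rho M : R) : 0 < rho ->
  (forall e, 0 < e -> exists2 r : R, 0 < r & forall w : C, `|w| < r%:C ->
     `|h w - h 0 - w * a| <= e%:C * `|w|) ->
  (forall z : C^o, `|z| <= rho%:C -> differentiable h z) ->
  (forall z : C^o, `|z| <= rho%:C -> `|h z - h 0| <= M%:C) ->
  `|a| * rho%:C <= M%:C.
Proof.
move=> rho0 ha dh hM.
have rho0' : 0 <= rho%:C :> C by rewrite ler0c ltW.
have M0 : 0 <= M by have := hM 0; rewrite normr0 subrr normr0 => /(_ rho0'); rewrite ler0c.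
have [->|a0] := eqVneq a 0; first by rewrite normr0 mul0r ler0c.
have a_gt0 : 0 < `|a| by rewrite normr_gt0.
have [na na0 naE] := gt0_complex a_gt0.
pose t (w : C^o) : C^o := rho%:C * cexp w.
(* The factor [a^*] makes the limit |a|^2 rho real, so that a bound on real parts recovers the
   modulus of [a]. *)
pose H (w : C^o) : C^o := a^* * (h (t w) - h 0) * cexp (- w).
have tN (w : C^o) : `|t w| = (rho * expR (Re w))%:C.
  by rewrite /t normrM norm_cexp normc_real gtr0_norm// rmorphM.
have tle (w : C^o) : Re w <= 0 -> `|t w| <= rho%:C.
  by move=> w0; rewrite tN lecR ler_piMr ?(ltW rho0)// -expR0 ler_expR.
have dt (w : C^o) : differentiable t w.
  by apply: differentiableM; [exact: differentiable_cst|exact: cexp_differentiable].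
have dH (w : C^o) : Re w <= 0 -> differentiable H w.
  move=> w0; apply: differentiableM; first apply: differentiableM.
  - exact: differentiable_cst.
  - apply: differentiableB; last exact: differentiable_cst.
    by apply: differentiable_comp; [exact: dt|apply: dh; exact: tle].
  - apply: differentiable_comp; last exact: cexp_differentiable.
    exact: differentiableN.
have naJ : `|a^*%C| = na%:C by rewrite normcJ.
have expN (w : C^o) : `|cexp (- w)| = (expR (- Re w))%:C by rewrite norm_cexp; case: w.
have tK (w : C^o) : t w * cexp (- w) = rho%:C.
  have cexp0 : cexp 0 = 1 :> C by rewrite /cexp /= expR0 cos0 sin0; exact: (@mulr1 C).
  by rewrite /t -mulrA -cexpD subrr cexp0 mulr1.
suff : na ^+ 2 * rho <= na * M.
  by rewrite expr2 -mulrA ler_pM2l// naE -(rmorphM (real_complex R)) lecR.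
apply: (@cylinder_bound R (fun x y => Re (H (x +i* y))) (fun x y => Im (H (x +i* y))) (pi *+ 2)).
- by rewrite mulrn_wgt0// pi_gt0.
- by move=> x y x0; apply: complex_cauchy_riemann; exact: dH.
- move=> x x0; suff -> : H (x +i* (pi *+ 2)) = H (x +i* 0) by [].
  have cexp2pi : cexp (x +i* (pi *+ 2)) = cexp (x +i* 0).
    by rewrite /cexp /= cos2pi sin2pi cos0 sin0.
  have cexpN2pi : cexp (- (x +i* (pi *+ 2))) = cexp (- (x +i* 0)).
    by rewrite /cexp /= cosN sinN cos2pi sin2pi oppr0 cos0 sin0.
  by rewrite /H /t cexp2pi cexpN2pi.
- move=> y; rewrite -lecR (le_trans (Re_le_normc _))// /H normrM expN normrM naJ /= oppr0 expR0 mulr1.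
  rewrite rmorphM ler_wpM2l ?ler0c ?(ltW na0)//.
  by apply: hM; apply: tle.
(* With e' = e / (|a| rho), the distance from H w to its limit is at most |a| e' |t w| exp(- Re w) =
   |a| e' rho = e. *)
move=> e e0; have e'0 : 0 < e / (na * rho) by rewrite divr_gt0// mulr_gt0.
have [r r0 rP] := ha _ e'0.
pose x := Num.min (- 1) (ln (r / (2 * rho))).
have x0 : x < 0 by rewrite gt_min ltrN10.
have expx : rho * expR x < r.
  have q0 : 0 < r / (2 * rho) by rewrite divr_gt0// mulr_gt0.
  have : expR x <= r / (2 * rho) by rewrite -[leRHS](lnK q0) ler_expR ge_min lexx orbT.
  rewrite -(ler_pM2l rho0) => /le_lt_trans; apply.
  have -> : rho * (r / (2 * rho)) = r / 2 by field; rewrite gt_eqF.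
  by rewrite ltr_pdivrMr// ltr_pMr// ltr1n.
exists x => // y; pose w : C^o := x +i* y.
have twr : `|t w| < r%:C by rewrite tN ltcR.
have ht := rP _ twr.
have HE : H w - (na ^+ 2 * rho)%:C = a^* * (h (t w) - h 0 - t w * a) * cexp (- w).
  have -> : (na ^+ 2 * rho)%:C = a^* * (t w * a) * cexp (- w).
    rewrite rmorphM rmorphXn /= -naE sqr_normc -(tK w); ring.
  by rewrite /H; ring.
have -> : Re (H w) - na ^+ 2 * rho = Re (H w - (na ^+ 2 * rho)%:C) by case: (H w).
rewrite -lecR (le_trans (Re_le_normc _))// HE normrM expN normrM naJ.
apply: le_trans (_ : na%:C * ((e / (na * rho))%:C * `|t w|) * (expR (- Re w))%:C <= _).
  by rewrite ler_wpM2r ?ler0c ?expR_ge0// ler_wpM2l ?ler0c ?(ltW na0).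
rewrite tN -!(rmorphM (real_complex R)) lecR /= le_eqVlt; apply/orP; left; apply/eqP.
rewrite expRN; field; rewrite !gt_eqF ?expR_gt0//.
Qed.
End CauchyEstimate.

(** * Tangent spaces of smooth sets *)

Lemma mx_norm_entry (K : numDomainType) m n (M : 'M[K]_(m, n)) i j : `|M i j| <= `|M|.
Proof.
rewrite [leRHS]/Num.norm /= mx_normE -[leLHS]nngE num_le.
exact: (le_bigmax _ (fun ij => `|M ij.1 ij.2|%:nng) (i, j)).
Qed.

Lemma mx_norm_leP (K : numDomainType) m n (M : 'M[K]_(m, n)) (e : K) : 0 <= e ->
  (forall i j, `|M i j| <= e) -> `|M| <= e.
Proof.
move=> e0 Me; rewrite [leLHS]/Num.norm /= mx_normE -[e]/(NngNum e0)%:num num_le.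
by apply/bigmax_leP; split=> // ij _; rewrite -num_le /=.
Qed.

Lemma mul_jacobian (K : numFieldType) n k (g : 'rV[K]_n -> 'rV[K]_k) x v :
  v *m 'J g x = 'd g x v.
Proof. exact: mul_rV_lin1. Qed.

Lemma mulmx_bound (K : numFieldType) n k (A : 'M[K]_(n, k)) :
  exists2 r : K, 0 < r & forall v : 'rV[K]_n, `|v *m A| <= r * `|v|.
Proof.
exists (n%:R * `|A| + 1).
  by rewrite ltr_wpDl ?ltr01// mulr_ge0.
move=> v; apply: mx_norm_leP => [|i j]; first by rewrite mulr_ge0// addr_ge0// mulr_ge0.
rewrite mxE (le_trans (ler_norm_sum _ _ _))// mulrDl mul1r ler_wpDr//.
rewrite -mulrA (_ : n%:R * _ = \sum_(l < n) (`|A| * `|v|)); last first.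
  by rewrite sumr_const card_ord mulr_natl.
apply: ler_sum => l _.
by rewrite normrM mulrC ler_pM// mx_norm_entry.
Qed.

(* The matrix topologies are found by unification only over an opaque
   numFieldType, not over the concrete R[i]. *)
Definition complex_field (R : realType) : numFieldType := R[i].

Section StrictDifferentiability.
Variable R : realType.
Local Notation C := R[i].
Local Notation KC := (complex_field R).
Local Open Scope complex_scope.
Local Notation Re := complex.Re.
Local Notation Im := complex.Im.

Lemma eps_is_derive (f : R -> R) (x df : R) :
  (forall e, 0 < e -> exists2 r, 0 < r & forall t, `|t| < r ->
    `|f (x + t) - f x - df * t| <= e * `|t|) -> is_derive x 1 f df.
Proof.
move=> fP.
have fcvg : (fun t => t^-1 *: (f (t *: 1 + x) - f x)) @ 0^' --> df.
  apply/cvgrPdist_le => e /fP[r r0 rP].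
  apply/nbhs_ballP; exists r => //= t; rewrite /ball /= sub0r normrN => tr t0.
  rewrite /GRing.scale /= mulr1 (addrC _ x).
  have -> : df - t^-1 * (f (x + t) - f x) = - (t^-1 * (f (x + t) - f x - df * t)).
    by field.
  by rewrite normrN normrM normfV ler_pdivrMl ?normr_gt0// [leRHS]mulrC rP.
apply: DeriveDef; first by apply/cvg_ex; exists df.
exact/cvg_lim.
Qed.

(** Real and imaginary parts pass through the mean value estimate separately, hence the factor 2. *)
Lemma line_increment (h : C^o -> C^o) (K : R) :
  (forall s : R, 0 <= s <= 1 -> differentiable h (s%:C : C^o)) ->
  (forall s : R, 0 <= s <= 1 -> `|'d h (s%:C : C^o) 1 : C| <= K%:C) ->
  `|h 1 - h 0 : C| <= (2 * K)%:C.
Proof.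
move=> dh hK.
have part (p : C -> R) : (forall a b, p (a - b) = p a - p b) ->
    (forall a (t : R), p (t%:C * a) = p a * t) ->
    (forall a, `|p a|%:C <= `|a|) -> `|p (h 1) - p (h 0)| <= K.
  move=> pB pM pN.
  have := @increment_approx R (fun s => p (h s%:C)) (fun s => p ('d h (s%:C : C^o) 1)) 0 K 0 1.
  rewrite mul0r !subr0 mulr1; apply=> //.
    move=> s s01; apply: eps_is_derive => e e0.
    have [r r0 rP] := differentiable_complex_eps (dh s s01) e0.
    exists r => // t tr; have := rP t%:C; rewrite normc_real ltcR => /(_ tr) H.
    rewrite -(rmorphM (real_complex R)) in H.
    have := le_trans (pN _) H; rewrite !pB pM lecR.
    by rewrite rmorphD.
  by move=> s s01; rewrite subr0 -lecR (le_trans (pN _))// hK.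
rewrite (le_trans (normc_Re_Im_le _))// lecR mulr_natl mulr2n lerD//.
  have := part (@complex.Re R); rewrite -(_ : Re (h 1 - h 0) = Re (h 1) - Re (h 0)); last first.
    by case: (h 1); case: (h 0).
  apply; [by case=> ? ? []|by case=> a b t /=; rewrite mul0r subr0 mulrC|exact: Re_le_normc].
have := part (@complex.Im R); rewrite -(_ : Im (h 1 - h 0) = Im (h 1) - Im (h 0)); last first.
  by case: (h 1); case: (h 0).
apply; [by case=> ? ? []|by case=> a b t /=; rewrite mul0r addr0 mulrC|exact: Im_le_normc].
Qed.

Lemma cauchy_estimate_at (h : C^o -> C^o) (z : C^o) (rho M : R) : 0 < rho ->
  (forall w : C^o, `|w| <= rho%:C -> differentiable h (z + w)) ->
  (forall w : C^o, `|w| <= rho%:C -> `|h (z + w) - h z| <= M%:C) ->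
  `|'d h z 1 : C| * rho%:C <= M%:C.
Proof.
move=> rho0 dh hM; have z0 : z + 0 = z by rewrite addr0.
have dhz : differentiable h z by rewrite -z0; apply: dh; rewrite normr0 ler0c ltW.
apply: (@cauchy_estimate R (fun w => h (z + w)) _ rho M rho0).
- by move=> e /(differentiable_complex_eps dhz)[r r0 rP]; exists r => // w /rP; rewrite z0.
- move=> w wr; apply: (@differentiable_comp _ _ _ _ (fun w : C^o => z + w) h); last exact: dh.
  by apply: differentiableD; [exact: differentiable_cst|exact: ex_diff].
- by move=> w wr; rewrite z0; exact: hM.
Qed.

Lemma norm_complex_real (V : normedModType C) (v : V) : exists2 a : R, 0 <= a & `|v| = a%:C.
Proof.
have : 0 <= `|v| by exact: normr_ge0.
by case: `|v| => a b; rewrite lecE /= => /andP[/eqP -> a0]; exists a.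
Qed.

Lemma near_complexP (V : normedModType C) (x : V) (P : set V) :
  (\forall y \near x, P y) <->
  exists2 r : R, 0 < r & forall h, `|h| < r%:C -> P (x + h).
Proof.
split=> [/nbhs_normP[r /= /gt0_complex[r' r'0 ->] rP]|[r r0 rP]].
  by exists r' => // h hr; apply: rP; rewrite /= opprD addNKr normrN.
apply/nbhs_normP; exists r%:C => /=; first by rewrite ltcR.
by move=> y; rewrite /= distrC => /rP; rewrite addrC subrK.
Qed.

Lemma strictly_differentiable n k (g : 'rV[KC]_n -> 'rV[KC]_k) (x : 'rV[KC]_n) :
  (\forall y \near x, differentiable g y) ->
  forall e : R, 0 < e -> exists2 r : R, 0 < r &
    forall y z, `|y - x| < r%:C -> `|z - x| < r%:C ->
      `|g y - g z - (y - z) *m 'J g x| <= e%:C * `|y - z|.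
Proof.
move=> dg e e0; have dgx : differentiable g x by exact: nbhs_singleton dg.
(* On the complex line through [z] and [y], discs of parameter radius r / |v| centred on the segment
   stay within 2 r of [x], so [G] differs from its value at the centre by at most 2 eps r + eps r.
   Cauchy's estimate bounds the derivative by 3 eps |v|, and [line_increment] doubles this. *)
pose eps := e / 6; have eps0 : 0 < eps by rewrite divr_gt0.
have eps0' : 0 < eps%:C :> C by rewrite ltcR.
have /near_complexP[r1 r10 r1P] := dg.
have /near_complexP[r2 r20 r2P] := differentiable_eps dgx eps0'.
pose r := Num.min r1 r2 / 3.
have r0 : 0 < r by rewrite divr_gt0// lt_min r10 r20.
have rr1 : 3 * r <= r1 by rewrite /r mulrC divfK// ge_min lexx.
have rr2 : 3 * r <= r2 by rewrite /r mulrC divfK// ge_min lexx orbT.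
pose G y := g y - 'd g x y.
have dG h : `|h| < (3 * r)%:C -> differentiable G (x + h).
  move=> hr; apply: differentiableB.
    by apply: r1P; rewrite (lt_le_trans hr)// lecR.
  by apply: linear_differentiable => u; exact: diff_continuous.
have Gsmall h : `|h| < (3 * r)%:C -> `|G (x + h) - G x| <= eps%:C * `|h|.
  move=> hr; have -> : G (x + h) - G x = g (x + h) - g x - 'd g x h.
    by rewrite /G linearD /= opprB opprD [- 'd g x x - _]addrC !addrA subrK addrAC.
  by have := r2P h; rewrite add0r; apply; rewrite (lt_le_trans hr)// lecR.
exists r => // y z yr zr; pose v := y - z.
have -> : g y - g z - (y - z) *m 'J g x = G y - G z.
  by rewrite mul_jacobian linearB /= /G !opprB !addrA addrAC [g y - _ - _]addrAC [in RHS]addrAC.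
have [v0|v0] := eqVneq v 0.
  by move: (v0) => /eqP; rewrite subr_eq0 => /eqP ->; rewrite !subrr !normr0 mulr0.
have /gt0_complex[nv nv0 nvE] : 0 < `|v| by rewrite normr_gt0.
have seg (s : R) : 0 <= s <= 1 -> `|z + s%:C *: v - x| < r%:C.
  move=> /andP[s0 s1]; have -> : z + s%:C *: v - x = (1 - s)%:C *: (z - x) + s%:C *: (y - x).
    by rewrite rmorphB rmorph1; apply/rowP => i; rewrite !mxE; ring.
  rewrite (le_lt_trans (ler_normD _ _))// !normrZ !normc_real !ger0_norm ?subr_ge0//.
  have [a a0 aE] := norm_complex_real (z - x); have [b b0 bE] := norm_complex_real (y - x).
  move: yr zr; rewrite aE bE !ltcR => br ar.
  rewrite -!(rmorphM (real_complex R)) -(rmorphD (real_complex R)) ltcR.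
  have -> : r = (1 - s) * r + s * r by ring.
  have [s00|s00] := eqVneq s 0; first by rewrite s00 !mul0r !addr0 subr0 !mul1r.
  rewrite ler_ltD// ?ler_wpM2l ?subr_ge0 ?(ltW ar)// ltr_pM2l//.
  by rewrite lt_neqAle eq_sym s00.
rewrite nvE; apply: mx_norm_leP => [|i l]; first by rewrite -(rmorphM (real_complex R)) ler0c mulr_ge0// ltW.
rewrite (ord1 i) {i}.
pose h (s : C^o) : C^o := G (z + s *: v) 0 l.
have wv (w : C) : `|w| <= (r / nv)%:C -> `|w *: v| <= r%:C.
  move=> wr; rewrite normrZ nvE (le_trans (ler_wpM2r _ wr)) ?ler0c ?(ltW nv0)//.
  by rewrite -(rmorphM (real_complex R)) /= divfK// gt_eqF.
have inball (s : R) (w : C) : 0 <= s <= 1 -> `|w| <= (r / nv)%:C ->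
    exists2 u, z + (s%:C + w) *: v = x + u & `|u| < (2 * r)%:C.
  move=> s01 wr; exists (z + s%:C *: v - x + w *: v).
    by rewrite scalerDl addrA addrA [x + _]addrC subrK.
  by rewrite (le_lt_trans (ler_normD _ _))// mulr_natl mulr2n rmorphD ltr_leD ?seg ?wv.
have lt23 : (2 * r)%:C < (3 * r)%:C :> C by rewrite ltcR ltr_pM2r// ltr_nat.
have w0 : `|0 : C| <= (r / nv)%:C by rewrite normr0 ler0c divr_ge0 ?ltW.
have dh (s : R) (w : C^o) : 0 <= s <= 1 -> `|w| <= (r / nv)%:C -> differentiable h ((s%:C : C^o) + w).
  move=> s01 /(inball _ _ s01)[u uE ur].
  apply: (@differentiable_comp _ _ _ _ (fun t : C^o => G (z + t *: v)) (fun M : 'rV[KC]_k => M 0 l : C^o));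
    last exact: differentiable_coord.
  apply: (@differentiable_comp _ _ _ _ (fun t : C^o => z + t *: v) G).
    apply: differentiableD; first exact: differentiable_cst.
    by case: (is_diff_scalel ((s%:C : C^o) + w) v).
  by rewrite uE; apply: dG; exact: lt_trans lt23.
have hbound (s : R) : 0 <= s <= 1 -> `|'d h (s%:C : C^o) 1 : C| <= (3 * eps * nv)%:C.
  move=> s01; have rnv0 : 0 < r / nv by rewrite divr_gt0.
  have H := @cauchy_estimate_at h (s%:C : C^o) (r / nv) (3 * eps * r) rnv0 (fun w => dh s w s01).
  have {}H : `|'d h (s%:C : C^o) 1 : C| * (r / nv)%:C <= (3 * eps * r)%:C.
    apply: H => w wr; have [u uE ur] := inball _ _ s01 wr.
    have [u' u'E _] := inball _ _ s01 w0; rewrite addr0 in u'E.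
    have u'r : `|u'| < r%:C by rewrite -(addKr x u') -u'E addrC seg.
    rewrite /h uE u'E.
    have sub_entry (M1 M2 M3 : 'rV[KC]_k) : M1 0 l - M2 0 l = ((M1 - M3) - (M2 - M3)) 0 l.
      by rewrite opprB addrA subrK !mxE.
    rewrite (sub_entry _ _ (G x)).
    rewrite (le_trans (mx_norm_entry _ _ _))// (le_trans (ler_normB _ _))//.
    have -> : (3 * eps * r)%:C = eps%:C * (2 * r)%:C + eps%:C * r%:C.
      by rewrite -!(rmorphM (real_complex R)) -(rmorphD (real_complex R)); congr (_%:C); ring.
    have r13 : r%:C < (3 * r)%:C :> C by rewrite ltcR ltr_pMl// ltr1n.
    rewrite lerD//.
      rewrite (le_trans (Gsmall _ _))//; first exact: lt_trans lt23.
      by rewrite ler_wpM2l ?ltW.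
    rewrite (le_trans (Gsmall _ _))//; first exact: lt_trans r13.
    by rewrite ler_wpM2l ?ltW.
  have rnv0' : 0 < (r / nv)%:C :> C by rewrite ltcR.
  rewrite -(ler_pM2r rnv0') (le_trans H)// -(rmorphM (real_complex R)) lecR /=.
  by rewrite le_eqVlt; apply/orP; left; apply/eqP; field; rewrite gt_eqF.
have := @line_increment h (3 * eps * nv).
have -> : (2 * (3 * eps * nv))%:C = e%:C * nv%:C.
  by rewrite -(rmorphM (real_complex R)); congr (_%:C); rewrite /eps; field.
rewrite /h scale1r scale0r addr0 /v [z + (y - z)]addrC subrK !mxE; apply=> // s s01.
by have := dh s 0 s01 w0; rewrite addr0.
Qed.
End StrictDifferentiability.

HB.instance Definition _ (R : realType) m n := Complete.on 'M[R]_(m, n).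

(** * Zeros near tangent vectors, by contraction *)

Section ImplicitZero.
Variable R : realType.
Local Notation C := R[i].
Local Notation KC := (complex_field R).
Local Open Scope complex_scope.

(** The contraction is run on real coordinates, C^k being read as R^(k + k); joining costs a factor
    2 in the norm. *)
Definition join_complex k (w : 'rV[R]_(k + k)) : 'rV[KC]_k :=
  \row_j (lsubmx w 0 j +i* rsubmx w 0 j).

Definition split_complex k (z : 'rV[KC]_k) : 'rV[R]_(k + k) :=
  row_mx (\row_j complex.Re (z 0 j : C)) (\row_j complex.Im (z 0 j : C)).

Lemma split_complexK k : cancel (@split_complex k) (@join_complex k).
Proof.
move=> z; apply/rowP => j; rewrite mxE row_mxKl row_mxKr !mxE.
by case: (z 0 j).
Qed.

Lemma join_complexB k (w w' : 'rV[R]_(k + k)) :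
  join_complex w - join_complex w' = join_complex (w - w').
Proof. by apply/rowP => j; rewrite !mxE. Qed.

Lemma split_complexB k (z z' : 'rV[KC]_k) :
  split_complex z - split_complex z' = split_complex (z - z').
Proof.
rewrite /split_complex opp_row_mx add_row_mx; congr row_mx; apply/rowP => j; rewrite !mxE.
  by case: (z 0 j) => ? ?; case: (z' 0 j).
by case: (z 0 j) => ? ?; case: (z' 0 j).
Qed.

Lemma norm_join_complex k (w : 'rV[R]_(k + k)) :
  `|join_complex w| <= (2 * `|w|)%:C.
Proof.
apply: mx_norm_leP => [|i j]; first by rewrite ler0c mulr_ge0.
rewrite !mxE (le_trans (normc_Re_Im_le _))// lecR mulr_natl mulr2n lerD//=.
  exact: mx_norm_entry.
exact: mx_norm_entry.
Qed.

Lemma norm_split_complex k (z : 'rV[KC]_k) (e : R) : 0 <= e ->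
  `|z| <= e%:C -> `|split_complex z| <= e.
Proof.
move=> e0 ze; apply: mx_norm_leP => // i j.
rewrite !mxE; case: (fintype.split j) => l; rewrite mxE -lecR.
  exact: le_trans (Re_le_normc _) (le_trans (mx_norm_entry _ _ _) ze).
exact: le_trans (Im_le_normc _) (le_trans (mx_norm_entry _ _ _) ze).
Qed.

(** The correction is sought as [join_complex w *m B] with [B *m A = 1]. It moves the linear part of
    [g] by exactly [join_complex w], so a zero of [g] amounts to a fixed point of minus the
    remainder [E], and strict differentiability makes that map contracting. *)
Lemma zero_near_tangent n k (g : 'rV[KC]_n -> 'rV[KC]_k) (x v : 'rV[KC]_n) :
  (\forall y \near x, differentiable g y) -> g x = 0 ->
  \rank ('J g x) = k -> v *m 'J g x = 0 ->
  forall e : R, 0 < e -> exists2 r : R, 0 < r & forall t : R, 0 < t -> t < r ->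
    exists2 u : 'rV[KC]_n, `|u| <= (e * t)%:C & g (x + (t%:C : KC) *: v + u) = 0.
Proof.
move=> dg gx0 rkA vA0 e e0; set A := 'J g x in rkA vA0.
have /row_fullP[B BA] : row_full A by rewrite /row_full rkA.
have [b0 b00 bP] := mulmx_bound B.
have [b b_gt0 bE] : exists2 b : R, 0 < b & b0 = b%:C by exact: gt0_complex.
rewrite {}bE in b00 bP.
have [nv nv0 nvE] := norm_complex_real v.
(* The first bound gives the Lipschitz constant 2 b e' <= 1/2. The second, with the radius [rho]
   below, gives |u| <= 2 b rho = 4 b e' (nv + 1) t <= e t. The + 1 keeps [rho] positive when v =
   0. *)
pose e' := Num.min (4 * b)^-1 (e / (4 * b * (nv + 1))).
have nv1 : 0 < nv + 1 by rewrite ltr_wpDl.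
have b4 : 0 < 4 * b by rewrite mulr_gt0.
have e'0 : 0 < e' by rewrite lt_min invr_gt0 b4 divr_gt0// mulr_gt0.
have e'b : 4 * b * e' <= 1.
  by rewrite mulrC -ler_pdivlMr// div1r ge_min lexx.
have e'e : 4 * b * e' * (nv + 1) <= e.
  have h : e' <= e / (4 * b * (nv + 1)) by rewrite ge_min lexx orbT.
  by rewrite mulrAC mulrC -ler_pdivlMr// mulr_gt0.
have [r r0 rP] := strictly_differentiable dg e'0.
(* The points [y w] with |w| <= rho lie within t nv + 2 b rho <= t (2 nv + 1) of [x]. *)
exists (r / (2 * nv + 1)).
  by rewrite divr_gt0// ltr_wpDl// mulr_ge0.
move=> t t0; rewrite ltr_pdivlMr; last by rewrite ltr_wpDl// mulr_ge0.
move=> tr; pose rho := 2 * e' * t * (nv + 1).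
have rho0 : 0 < rho by rewrite !mulr_gt0.
pose y (w : 'rV[R]_(k + k)) := x + (t%:C : KC) *: v + join_complex w *m B.
pose E z := g z - g x - (z - x) *m A.
have tv : `|(t%:C : KC) *: v| = (t * nv)%:C.
  by rewrite normrZ nvE [ `|_ : KC|]normc_real gtr0_norm// rmorphM.
pose U : set 'rV[R]_(k + k) := [set w | `|w| <= rho].
have b0' : 0 <= b%:C :> C by rewrite ler0c ltW.
have Bw w : `|join_complex w *m B| <= (b * (2 * `|w|))%:C.
  by rewrite (le_trans (bP _))// rmorphM ler_wpM2l// norm_join_complex.
have yx w : U w -> `|y w - x| <= (t * nv + b * (2 * rho))%:C.
  move=> Uw; have -> : y w - x = (t%:C : KC) *: v + join_complex w *m B.
    by rewrite /y addrC -addrA addKr.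
  rewrite (le_trans (ler_normD _ _))// rmorphD lerD ?tv// (le_trans (Bw _))// lecR.
  by rewrite ler_pM2l// ler_pM2l.
have yr w : U w -> `|y w - x| < r%:C.
  move=> /yx/le_lt_trans; apply; rewrite ltcR (le_lt_trans _ tr)//.
  have -> : t * (2 * nv + 1) = t * nv + t * (nv + 1) by ring.
  rewrite lerD2l; have -> : b * (2 * rho) = 4 * b * e' * (t * (nv + 1)) by rewrite /rho; ring.
  by rewrite ler_piMl// mulr_ge0// ltW.
have x_r : `|x - x| < r%:C by rewrite subrr normr0 ltcR.
pose f w : 'rV[R]_(k + k) := split_complex (- E (y w)).
have E0 z : E z = g z - g x - (z - x) *m A by [].
have fU w : U w -> U (f w).
  move=> Uw; apply: norm_split_complex; first exact: ltW.
  rewrite normrN (le_trans (rP _ _ (yr _ Uw) x_r))//.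
  apply: (@le_trans _ _ (e'%:C * (t * nv + b * (2 * rho))%:C)).
    by rewrite ler_wpM2l ?ler0c ?(ltW e'0)// yx.
  rewrite -(rmorphM (real_complex R)) lecR.
  have h1 : 4 * b * e' * rho <= rho by rewrite ler_piMl// ltW.
  have h2 : 0 <= e' * t by rewrite mulr_ge0 ?ltW.
  have h3 : rho = 2 * (e' * t * nv) + 2 * (e' * t) by rewrite /rho; ring.
  have -> : e' * (t * nv + b * (2 * rho)) = e' * t * nv + (4 * b * e' * rho) / 2 by field.
  have h4 : 0 <= e' * t * nv by rewrite mulr_ge0.
  move: h1 h2 h3 h4; clear; move: (4 * b * e' * rho) (e' * t * nv) (e' * t) => p q s.
  by lra.
have fLip w w' : U w -> U w' -> `|f w - f w'| <= 2^-1 * `|w - w'|.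
  move=> Uw Uw'; rewrite /f split_complexB.
  have -> : - E (y w) - - E (y w') = - (g (y w) - g (y w') - (y w - y w') *m A).
    have -> : (y w - y w') *m A = (y w - x) *m A - (y w' - x) *m A.
      by rewrite -mulmxBl opprB addrA subrK.
    have cancel_c (p q a a' d : 'rV[KC]_k) :
        - (a - d - p) - - (a' - d - q) = - (a - a' - (p - q)).
      by apply/rowP => i; rewrite !mxE; ring.
    exact: cancel_c.
  apply: norm_split_complex; first by rewrite mulr_ge0.
  rewrite normrN (le_trans (rP _ _ (yr _ Uw) (yr _ Uw')))//.
  have -> : y w - y w' = join_complex (w - w') *m B.
    by rewrite /y -join_complexB mulmxBl opprD addrACA subrr add0r.
  apply: (@le_trans _ _ (e'%:C * (b * (2 * `|w - w'|))%:C)).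
    by rewrite ler_wpM2l ?ler0c ?(ltW e'0).
  rewrite -(rmorphM (real_complex R)) lecR.
  have -> : e' * (b * (2 * `|w - w'|)) = (4 * b * e') * (2^-1 * `|w - w'|) by field.
  by rewrite ler_piMl// mulr_ge0.
have fU' : {homo f : w / U w >-> U w} by exact: fU.
pose F := mkfun_fun fU'.
have ctr : is_contraction F.
  exists (2^-1)%:nng; split => /=; first by rewrite invf_lt1 ?ltr1n.
  move=> [w w'] /= [Uw Uw']; exact: fLip.
have Ucl : closed U.
  rewrite (_ : U = (fun w : 'rV[R]_(k + k) => `|w|) @^-1` [set s | s <= rho])//.
  apply: preimage_closed; last exact: closed_le.
  by move=> w _; exact: norm_continuous.
have [w Uw wE] : exists2 w, U w & w = F w.
  by apply: (banach_fixed_point ctr Ucl); exists 0; rewrite /U /= normr0 ltW.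
exists (join_complex w *m B).
  rewrite (le_trans (Bw _))// lecR.
  apply: (@le_trans _ _ (b * (2 * rho))); first by rewrite ler_pM2l// ler_pM2l.
  have -> : b * (2 * rho) = 4 * b * e' * (nv + 1) * t by rewrite /rho; ring.
  by rewrite ler_pM2r.
have : join_complex w = - E (y w) by rewrite {1}wE; exact: split_complexK.
have -> : E (y w) = g (y w) - join_complex w.
  rewrite E0 gx0 subr0; congr (_ - _).
  have -> : y w - x = (t%:C : KC) *: v + join_complex w *m B by rewrite /y addrC -addrA addKr.
  by rewrite mulmxDl -scalemxAl vA0 scaler0 add0r -mulmxA BA mulmx1.
rewrite opprB => /eqP; rewrite eq_sym -subr_eq0 addrAC subrr add0r oppr_eq0.
by move/eqP.
Qed.
End ImplicitZero.

Section TangentSpace.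
Variable R : realType.
Local Notation C := R[i].
Local Notation KC := (complex_field R).
Local Open Scope complex_scope.

(** For v in the kernel for [g], the zeros x + t v + u of [g] with |u| <= e t lie in [S], hence are
    zeros of [g']. Dividing the first-order expansion of [g'] by t bounds the image of v by a
    constant times e, for every small e. *)
Lemma kermx_jacobian_sub n k k' (S : set 'rV[KC]_n) x
    (g : 'rV[KC]_n -> 'rV[KC]_k) (g' : 'rV[KC]_n -> 'rV[KC]_k') :
  S x -> local_equations S x g -> local_equations S x g' ->
  (kermx ('J g x) <= kermx ('J g' x))%MS.
Proof.
move=> Sx [dg gS rkg] [dg' gS' _]; apply/row_subP => i; apply/sub_kermxP.
set v := row i _; have vJ : v *m 'J g x = 0.
  by apply/sub_kermxP; rewrite row_sub.
have gx0 : g x = 0 by apply: (nbhs_singleton gS).1.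
have gx0' : g' x = 0 by apply: (nbhs_singleton gS').1.
have dgx' : differentiable g' x := nbhs_singleton dg'.
apply/eqP; rewrite -normr_eq0; have [N N0 NE] := norm_complex_real (v *m 'J g' x); rewrite NE.
have [b b0 bP] := mulmx_bound ('J g' x).
have [b' b'0 bE] := gt0_complex b0; rewrite {b b0}bE in bP.
have [nv nv0 nvE] := norm_complex_real v.
have main e : 0 < e -> e <= 1 -> N <= e * (b' + nv + 1).
  move=> e0 e1; have [r1 r10 r1P] := zero_near_tangent dg gx0 rkg vJ e0.
  have e0' : 0 < e%:C :> C by rewrite ltcR.
  have /near_complexP[r2 r20 r2P] := differentiable_eps dgx' e0'.
  have : \forall y \near x, g y = 0 <-> g' y = 0.
    by apply: filterS2 gS gS' => y h h'; split=> [/h/h'|/h'/h].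
  move=> /near_complexP[r3 r30 r3P].
  have nv1 : 0 < nv + 1 by rewrite ltr_wpDl.
  have [t t0 t2] : exists2 t, 0 < t & t < Num.min r1 (Num.min r2 r3 / (nv + 1)).
    have q0 : 0 < Num.min r1 (Num.min r2 r3 / (nv + 1)).
      by rewrite lt_min r10 divr_gt0// lt_min r20 r30.
    by exists (Num.min r1 (Num.min r2 r3 / (nv + 1)) / 2);
      rewrite ?divr_gt0// ltr_pdivrMr// ltr_pMr ?ltr1n.
  move: t2; rewrite lt_min => /andP[tr1]; rewrite ltr_pdivlMr// lt_min => /andP[tr2 tr3].
  have [u ue gu] := r1P _ t0 tr1.
  pose h := (t%:C : KC) *: v + u.
  have tv : `|(t%:C : KC) *: v| = (t * nv)%:C.
    by rewrite normrZ nvE [ `|_ : KC|]normc_real gtr0_norm// rmorphM.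
  have hle : `|h| <= (t * (nv + e))%:C.
    rewrite (le_trans (ler_normD _ _))// mulrDr rmorphD lerD ?tv//.
    by rewrite mulrC.
  have hle' : `|h| <= (t * (nv + 1))%:C.
    by rewrite (le_trans hle)// lecR ler_pM2l// lerD2l.
  have g'h : g' (x + h) = 0.
    have hr3 : `|h| < r3%:C by rewrite (le_lt_trans hle')// ltcR.
    by have [+ _] := r3P _ hr3; apply; rewrite /h addrA.
  have := r2P h; rewrite add0r => /(_ (le_lt_trans hle' _)).
  rewrite ltcR => /(_ tr2); rewrite g'h gx0' subrr sub0r normrN -mul_jacobian => hJ.
  have : `|(t%:C : KC) *: (v *m 'J g' x)| <= (t * (e * (b' + nv + 1)))%:C.
    have -> : (t%:C : KC) *: (v *m 'J g' x) = h *m 'J g' x - u *m 'J g' x.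
      by rewrite /h mulmxDl -scalemxAl addrK.
    rewrite (le_trans (ler_normB _ _))//.
    rewrite (le_trans (lerD (le_trans hJ (ler_wpM2l (ltW e0') hle')) (bP u)))//.
    rewrite (le_trans (lerD (lexx _) (ler_wpM2l _ ue)))//; first by rewrite ler0c ltW.
    rewrite -!(rmorphM (real_complex R)) -(rmorphD (real_complex R)) lecR.
    by rewrite le_eqVlt; apply/orP; left; apply/eqP; ring.
  rewrite normrZ NE [ `|_ : KC|]normc_real gtr0_norm// -(rmorphM (real_complex R)) lecR.
  by rewrite ler_pM2l.
have Q0 : 0 < b' + nv + 1 by rewrite ltr_wpDl// addr_ge0// ltW.
have : N <= 0.
  rewrite leNgt; apply/negP => Npos.
  pose e := Num.min 1 (N / (2 * (b' + nv + 1))).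
  have e0 : 0 < e by rewrite lt_min ltr01 divr_gt0// mulr_gt0.
  have e1 : e <= 1 by rewrite ge_min lexx.
  have := main e e0 e1; apply/negP; rewrite -ltNge.
  apply: (@le_lt_trans _ _ (N / 2)); last by rewrite ltr_pdivrMr// ltr_pMr// ltr1n.
  have : e <= N / (2 * (b' + nv + 1)) by rewrite ge_min lexx orbT.
  rewrite -(ler_pM2r Q0) => /le_trans; apply.
  by rewrite le_eqVlt; apply/orP; left; apply/eqP; field; rewrite gt_eqF.
by move=> N0'; apply/eqP; congr (_%:C); apply/eqP; rewrite eq_le N0' N0.
Qed.

Lemma kermx_jacobian_eq n k k' (S : set 'rV[KC]_n) x
    (g : 'rV[KC]_n -> 'rV[KC]_k) (g' : 'rV[KC]_n -> 'rV[KC]_k') :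
  S x -> local_equations S x g -> local_equations S x g' ->
  (kermx ('J g x) == kermx ('J g' x))%MS.
Proof.
move=> Sx lg lg'; apply/andP; split.
  exact: kermx_jacobian_sub Sx lg lg'.
exact: kermx_jacobian_sub Sx lg' lg.
Qed.
End TangentSpace.

(** * Strata of Laurent polynomials *)

Section LaurentDerivatives.
Variables (K : numFieldType) (n : nat).

Lemma diff_coord (s : 'I_n) (x v : 'rV[K]_n) : 'd (fun y : 'rV[K]_n => y 0 s : K^o) x v = v 0 s.
Proof.
have @f : {linear 'rV[K]_n -> K^o}.
  by exists (fun N : 'rV[K]_n => N 0 s); do 2![eexists]; do ?[constructor];
     rewrite ?mxE// => ? *; rewrite ?mxE//; move=> ?; rewrite !mxE.
rewrite -[fun y : 'rV_n => _]/(f : _ -> _) diff_lin//.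
exact: coord_continuous.
Qed.

(** Relative differentials add under products and change sign under inversion, which brings integer
    powers and monomials within easy reach. *)
Definition log_diff (f : 'rV[K]_n -> K^o) (y : 'rV[K]_n) (w : 'rV[K]_n -> K) : Prop :=
  differentiable f y /\ forall v, 'd f y v = f y * w v.

Lemma log_diffM f g y w w' : log_diff f y w -> log_diff g y w' ->
  log_diff (fun z => f z * g z) y (fun v => w v + w' v).
Proof.
move=> [df fw] [dg gw]; split; first exact: differentiableM.
move=> v; have -> : (fun z => f z * g z) = f * g by [].
rewrite (diffM df dg).
have -> : (f y *: ('d g y : _ -> K^o) + g y *: ('d f y : _ -> K^o)) v =
  f y * 'd g y v + g y * 'd f y v by [].
by rewrite fw gw; ring.
Qed.

Lemma log_diff_prod (I : Type) (r : seq I) (f : I -> 'rV[K]_n -> K^o) y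
    (w : I -> 'rV[K]_n -> K) : (forall i, log_diff (f i) y (w i)) ->
  log_diff (fun z => \prod_(i <- r) f i z) y (fun v => \sum_(i <- r) w i v).
Proof.
move=> fw; elim: r => [|i r IHr].
  have -> : (fun z => \prod_(i <- [::]) f i z) = cst (1 : K^o).
    by apply/funext => z; rewrite big_nil.
  split=> [|v]; first exact: differentiable_cst.
  by rewrite diff_cst big_nil mulr0.
have -> : (fun z => \prod_(j <- i :: r) f j z) = fun z => f i z * \prod_(j <- r) f j z.
  by apply/funext => z; rewrite big_cons.
have -> : (fun v => \sum_(j <- i :: r) w j v) = fun v => w i v + \sum_(j <- r) w j v.
  by apply/funext => v; rewrite big_cons.
exact: log_diffM.
Qed.

Lemma log_diffV f y w : f y != 0 -> log_diff f y w ->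
  log_diff (fun z => (f z)^-1) y (fun v => - w v).
Proof.
move=> fy [df fw]; split; first exact: differentiableV.
move=> v; rewrite (diffV df fy) /= fw /GRing.scale /=.
by field.
Qed.

Lemma log_diff_exprz f y w (z : int) : f y != 0 -> log_diff f y w ->
  log_diff (fun u => f u ^ z) y (fun v => z%:~R * w v).
Proof.
move=> fy fw; have fX (m : nat) : log_diff (fun u => f u ^+ m) y (fun v => m%:R * w v).
  have := @log_diff_prod nat (iota 0 m) (fun=> f) y (fun=> w) (fun=> fw).
  have -> : (fun z => \prod_(i <- iota 0 m) f z) = fun z => f z ^+ m.
    by apply/funext => u; rewrite big_const_seq count_predT size_iota -Monoid.iteropE.
  have -> : (fun v => \sum_(i <- iota 0 m) w v) = fun v => m%:R * w v.
    by apply/funext => u; rewrite big_const_seq count_predT size_iota iter_addr_0 mulr_natl.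
  exact.
case: z => m; first exact: fX.
have -> : (fun v => (Negz m)%:~R * w v) = fun v => - (m.+1%:R * w v).
  by apply/funext => v; rewrite NegzE mulrNz mulNr.
by apply: log_diffV (fX m.+1); rewrite expf_neq0.
Qed.

Lemma log_diff_monomial (b : 'rV[int]_n) (y : 'rV[K]_n) : torus y ->
  log_diff (fun z => \prod_(l < n) z 0 l ^ b 0 l) y
    (fun v => \sum_(s < n) (b 0 s)%:~R * (v 0 s / y 0 s)).
Proof.
move=> ty; apply: log_diff_prod => s; apply: log_diff_exprz; first exact: ty.
split; first exact: differentiable_coord.
by move=> v; rewrite diff_coord mulrC divfK//; exact: ty.
Qed.

Variable N : {fset 'rV[int]_n}.
Implicit Types c : {ffun N -> K}.

Lemma laurent_diff c (y : 'rV[K]_n) : torus y ->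
  differentiable (laurent c) y /\ forall v, 'd (laurent c) y v =
    \sum_(b : N) c b * (\prod_(l < n) y 0 l ^ (val b) 0 l) *
      \sum_(s < n) ((val b) 0 s)%:~R * (v 0 s / y 0 s).
Proof.
move=> ty; pose mon (b : N) (z : 'rV[K]_n) : K^o := \prod_(l < n) z 0 l ^ (val b) 0 l.
have ld (b : N) := log_diff_monomial (val b) ty.
suff H (r : seq N) : differentiable (fun z => \sum_(b <- r) c b * mon b z : K^o) y /\
    forall v, 'd (fun z => \sum_(b <- r) c b * mon b z : K^o) y v =
    \sum_(b <- r) c b * mon b y * \sum_(s < n) ((val b) 0 s)%:~R * (v 0 s / y 0 s).
  exact: H.
elim: r => [|b r [dr r']].
  have -> : (fun z => \sum_(b <- [::]) c b * mon b z : K^o) = cst (0 : K^o).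
    by apply/funext => z; rewrite big_nil.
  split=> [|v]; first exact: differentiable_cst.
  by rewrite diff_cst big_nil.
have [db b'] := ld b.
have -> : (fun z => \sum_(j <- b :: r) c j * mon j z : K^o) =
    c b *: (mon b : _ -> K^o) + (fun z => \sum_(b <- r) c b * mon b z : K^o).
  by apply/funext => z; rewrite big_cons.
have dcb : differentiable (c b *: (mon b : _ -> K^o)) y by exact: differentiableZ.
split=> [|v]; first exact: differentiableD.
by rewrite (diffD dcb dr) /= (diffZ _ db) /= b' r' big_cons /GRing.scale /= mulrA.
Qed.

Lemma torus_near (x : 'rV[K]_n) : torus x -> \forall y \near x, torus y.
Proof.
move=> tx; have xs (s : 'I_n) : \forall y \near x, (y : 'rV[K]_n) 0 s != 0.
  have := @coord_continuous K 1 n 0 s x; move=> /cvgrPdist_lt/(_ `|x 0 s|).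
  rewrite normr_gt0 => /(_ (tx s)); apply: filterS => y.
  by apply: contraTneq => ->; rewrite subr0 ltxx.
exact: filter_forall xs.
Qed.
End LaurentDerivatives.

(** * Iterated derivatives in the last variable *)

Section LastDerivatives.
Variables (K : numFieldType) (n : nat) (N : {fset 'rV[int]_n.+1}).

Definition falling (l : nat) (z : int) : K := \prod_(i < l) (z%:~R - i%:R).

Lemma fallingS l z : falling l.+1 z = falling l z * (z%:~R - l%:R).
Proof. by rewrite /falling big_ord_recr. Qed.

Definition falling_coefs (c : {ffun N -> K}) (l : nat) : {ffun N -> K} :=
  [ffun b => c b * falling l (last_coord (val b))].

Implicit Types c : {ffun N -> K}.

Lemma laurent_diff_last c (y : 'rV[K]_n.+1) : torus y ->
  'd (laurent c) y (delta_mx 0 ord_max) =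
  \sum_(b : N) c b * (\prod_(l < n.+1) y 0 l ^ (val b) 0 l) *
    ((last_coord (val b))%:~R / y 0 ord_max).
Proof.
move=> ty; rewrite (laurent_diff c ty).2; apply: eq_bigr => b _; congr (_ * _).
rewrite (bigD1 ord_max)//= big1 ?addr0 => [|s /negPf sm]; first by rewrite mxE !eqxx div1r.
by rewrite mxE sm andbF mul0r mulr0.
Qed.

(** In f_l x_n^(-l) the monomial coming from b has exponent h(b) - l in x_n, so one more derivative
    multiplies its coefficient by h(b) - l, the next factor of the falling factorial. *)
Lemma iter_dlast c l (y : 'rV[K]_n.+1) : torus y ->
  iter l (dlast (n := n)) (laurent c) y =
  laurent (falling_coefs c l) y * (y 0 ord_max) ^- l.
Proof.
elim: l y => [|l IHl] y ty.
  rewrite /= expr0 invr1 mulr1; apply: eq_bigr => b _.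
  by rewrite ffunE /falling big_ord0 mulr1.
rewrite iterS {1}/dlast.
pose g (z : 'rV[K]_n.+1) : K^o := (z 0 ord_max) ^- l.
have yl0 : y 0 ord_max != 0 := ty ord_max.
have lg : log_diff g y (fun v => (- (l%:Z))%:~R * (v 0 ord_max / y 0 ord_max)).
  have := @log_diff_exprz K n.+1 (fun z : 'rV[K]_n.+1 => z 0 ord_max : K^o) y
    (fun v => v 0 ord_max / y 0 ord_max) (- l%:Z) yl0.
  have -> : (fun u : 'rV[K]_n.+1 => (u 0 ord_max : K^o) ^ (- l%:Z)) = g.
    by apply/funext => u; rewrite /g -exprnN.
  apply; split; first exact: differentiable_coord.
  by move=> v; rewrite diff_coord mulrC divfK.
(* The induction hypothesis holds only on the torus, which is open, so it holds near [y] and may be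
   differentiated. *)
rewrite (@near_eq_derive _ _ _ _ (laurent (falling_coefs c l) * g)); last first.
  by apply: filterS (torus_near ty) => z /IHl.
have [df _] := laurent_diff (falling_coefs c l) ty; have [dg gd] := lg.
rewrite deriveE; last exact: differentiableM.
rewrite (diffM df dg).
rewrite -[LHS]/(laurent (falling_coefs c l) y * 'd g y (delta_mx 0 ord_max) +
  g y * 'd (laurent (falling_coefs c l)) y (delta_mx 0 ord_max)).
rewrite gd laurent_diff_last// mxE !eqxx /laurent mulr_suml mulr_sumr -big_split mulr_suml.
apply: eq_bigr => b _; rewrite !ffunE fallingS /g.
have -> : (- l%:Z)%:~R = - l%:R :> K by rewrite mulrNz.
rewrite exprSr invfM /=; move: (falling _ _) (\prod_(i < n.+1) _) (_ ^- l) ((y 0 ord_max)^-1).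
move: (c b) ((last_coord _)%:~R) (l%:R) => cb h l' a' p q r.
by ring.
Qed.

Lemma row_diff m k (f : 'I_k -> 'rV[K]_m -> K^o) (x : 'rV[K]_m) :
  (forall l, differentiable (f l) x) ->
  differentiable (fun y => \row_l f l y : 'rV[K]_k) x /\
  forall v l, (v *m 'J (fun y => \row_l f l y : 'rV[K]_k) x) 0 l = 'd (f l) x v.
Proof.
move=> df; set G := fun y => _.
have GE : G = \sum_(l < k) (fun y => f l y *: (delta_mx 0 l : 'rV[K]_k)).
  apply/funext => y; rewrite fct_sumE; apply/rowP => j; rewrite !mxE summxE (bigD1 j)//= big1 => [|i ij].
    by rewrite !mxE !eqxx mulr1 addr0.
  by rewrite !mxE (eq_sym j) (negPf ij) andbF mulr0.
have dG : differentiable G x.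
  by rewrite GE; apply: differentiable_sum => l; exact: differentiableZl.
split=> // v l.
rewrite [v *m _]mul_rV_lin1.
have -> : f l = (fun M : 'rV[K]_k => M 0 l : K^o) \o G.
  by apply/funext => y; rewrite /= mxE.
rewrite diff_comp//; last exact: differentiable_coord.
exact/esym/diff_coord.
Qed.
End LastDerivatives.

Section ForgetLast.
Variables (K : numFieldType) (n : nat).
Local Notation p := (@forget_last K n).
Local Notation e_last := (delta_mx 0 ord_max : 'rV[K]_n.+1).

Lemma jacobian_forget_last (x v : 'rV[K]_n.+1) : v *m 'J p x = p v.
Proof.
have [_ J] := @row_diff K n.+1 n (fun j y => y 0 (lift ord_max j) : K^o) x
  (fun j => differentiable_coord _ _ _).
by apply/rowP => j; rewrite [LHS]J diff_coord mxE.
Qed.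

Lemma jacobian_forget_last_eq0 (x v : 'rV[K]_n.+1) :
  v *m 'J p x = 0 -> v = v 0 ord_max *: e_last.
Proof.
rewrite jacobian_forget_last => /rowP v0; apply/rowP => s; rewrite !mxE eqxx /=.
case: (unliftP ord_max s) => [j ->|->]; last by rewrite eqxx mulr1.
by have := v0 j; rewrite !mxE => ->; rewrite [_ == ord_max]eq_sym (negPf (neq_lift _ _)) mulr0.
Qed.

(** Rank-nullity: the kernel of the differential of [p] is the line of [e_last], so rank can be lost
    only through that vector. *)
Lemma rank_forget_last_lt (x : 'rV[K]_n.+1) (T : 'M[K]_n.+1) :
  (\rank (T *m 'J p x) < \rank T)%N = (e_last <= T)%MS.
Proof.
have rkE := mxrank_mul_ker T ('J p x).
apply/idP/idP => [lt_rk|eT].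
  have : (T :&: kermx ('J p x))%MS != 0.
    rewrite -mxrank_eq0; apply: contraTneq lt_rk => r0.
    by rewrite -rkE r0 addn0 ltnn.
  move=> /rowV0Pn[v]; rewrite sub_capmx => /andP[vT /sub_kermxP/jacobian_forget_last_eq0 vE] v0.
  have vl0 : v 0 ord_max != 0 by apply: contraNneq v0 => vl; rewrite vE vl scale0r.
  have <- : (v 0 ord_max)^-1 *: v = e_last by rewrite {2}vE scalerA mulVf// scale1r.
  exact: scalemx_sub.
rewrite -rkE -[X in (X < _)%N]addn0 ltn_add2l lt0n mxrank_eq0.
apply/rowV0Pn; exists e_last.
  rewrite sub_capmx eT; apply/sub_kermxP; rewrite jacobian_forget_last.
  by apply/rowP => j; rewrite !mxE [_ == ord_max]eq_sym (negPf (neq_lift _ _)).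
by apply/eqP => /rowP/(_ ord_max)/eqP; rewrite !mxE !eqxx oner_eq0.
Qed.
End ForgetLast.

(** * Equations and regularity of the strata *)

Section LaurentStrata.
Variables (K : numFieldType) (n : nat) (N : {fset 'rV[int]_n.+1}) (c : {ffun N -> K}).
Local Notation e_last := (delta_mx 0 ord_max : 'rV[K]_n.+1).
Local Notation F l := (laurent (falling_coefs c l)).

Definition stratum (j : nat) : set 'rV[K]_n.+1 :=
  torus (n := n.+1) `&` [set y | forall l, (l <= j)%N -> F l y = 0].

Definition stratum_equations (j : nat) (y : 'rV[K]_n.+1) : 'rV[K]_j.+1 :=
  \row_(l < j.+1) F l y.

(** [k] counts equations: stratum [j] is cut out by F_0, ..., F_j and thus calls for
    [regular_coefs j.+1]. *)
Definition regular_coefs (k : nat) : Prop :=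
  @nondegenerate K N n.+1 k (fun b s => (val b) 0 s)
    (fun l b => falling K l (last_coord (val b))) c.

Lemma stratum_equationsP j y : torus y -> (stratum j y <-> stratum_equations j y = 0).
Proof.
move=> ty; split=> [[_ Fy]|/rowP Fy].
  by apply/rowP => l; rewrite !mxE Fy// -ltnS.
split=> // l lj; have := Fy (Ordinal (lj : (l < j.+1)%N)).
by rewrite !mxE.
Qed.

Lemma jacobian_stratum_equations j x : torus x -> forall v (l : 'I_j.+1),
  (v *m 'J (stratum_equations j) x) 0 l = 'd (F l) x v.
Proof.
move=> tx; apply: (row_diff (f := fun (l : 'I_j.+1) => F l) _).2 => l.
exact: (laurent_diff _ tx).1.
Qed.

Lemma rank_stratum_equations j x : regular_coefs j.+1 -> stratum j x ->
  \rank ('J (stratum_equations j) x) = j.+1.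
Proof.
move=> rc [tx Fx]; apply/eqP; rewrite -mxrank_tr -/(row_free _).
apply/inj_row_free => lam /rowP lamJ; apply/rowP => l; rewrite [RHS]mxE.
apply: (rc (fun s => x 0 s) tx _ (fun l => lam 0 l) _ l) => {l}.
  move=> l; have := Fx l (ltn_ord l); rewrite /laurent => Fl.
  by rewrite -[RHS]Fl; apply: eq_bigr => b _; rewrite ffunE.
(* Multiplying the s-th coordinate by x_s turns partial derivatives into the logarithmic ones of
   [nondegenerate]. *)
move=> s; have := lamJ s; rewrite !mxE => /(congr1 (fun t => x 0 s * t)).
rewrite mulr0 mulr_sumr => lamS; rewrite -[RHS]lamS; apply: eq_bigr => l _.
have -> : ('J (stratum_equations j) x)^T l s = 'd (F l) x (delta_mx 0 s).
  by rewrite -(jacobian_stratum_equations tx) -rowE [LHS]mxE [RHS]mxE.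
rewrite (laurent_diff _ tx).2 mulrCA; congr (_ * _).
rewrite mulr_sumr; apply: eq_bigr => b _.
rewrite [\sum_(_ < n.+1) _](bigD1 s)//= [X in _ + X]big1 => [|i /negPf si]; last by rewrite mxE si andbF mul0r mulr0.
rewrite mxE !eqxx ffunE addr0 /=.
have xs0 : x 0 s != 0 := tx s.
move: (falling _ _ _) (\prod_(_ < _) _) (_%:~R) => a' q r.
by field.
Qed.

Lemma stratum_local_equations j x : regular_coefs j.+1 -> stratum j x ->
  local_equations (stratum j) x (stratum_equations j).
Proof.
move=> rc Sx; split; last exact: rank_stratum_equations.
  apply: filterS (torus_near Sx.1) => y ty.
  apply: (row_diff (f := fun (l : 'I_j.+1) => F l) _).1 => l.
  exact: (laurent_diff _ ty).1.
by apply: filterS (torus_near Sx.1) => y; exact: stratum_equationsP.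
Qed.

(** Since x_n dF_l/dx_n = F_(l+1) + l F_l, on the stratum the derivatives with l < j vanish by
    themselves, and the one with l = j is F_(j+1) up to the unit x_n. *)
Lemma e_last_stratum j x : stratum j x ->
  e_last *m 'J (stratum_equations j) x = 0 <-> F j.+1 x = 0.
Proof.
move=> [tx Fx]; have xl0 : x 0 ord_max != 0 := tx ord_max.
have dF l : x 0 ord_max * 'd (F l) x e_last = F l.+1 x + l%:R * F l x.
  rewrite laurent_diff_last// mulr_sumr /laurent mulr_sumr -big_split.
  apply: eq_bigr => b _ /=; rewrite !ffunE fallingS.
  move: (falling _ _ _) (\prod_(_ < _) _) (_%:~R) => a' q r.
  by field.
split=> [/rowP/(_ ord_max)|Fj].
  rewrite (jacobian_stratum_equations tx) [RHS]mxE => d0.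
  have := dF j; rewrite (Fx j)// mulr0 addr0 => <-.
  have -> : 'd (F j) x e_last = 0 :> K by exact: d0.
  exact: mulr0.
apply/rowP => l; rewrite (jacobian_stratum_equations tx) [RHS]mxE.
have lj : (l <= j)%N by rewrite -ltnS.
apply: (mulfI xl0); rewrite dF mulr0 (Fx l lj) mulr0 addr0.
by move: lj; rewrite leq_eqVlt => /predU1P[->//|]; exact: Fx.
Qed.
End LaurentStrata.

Section ThomBoardman.
Variables (R : realType) (n : nat).
Local Notation KC := (complex_field R).
Variables (N : {fset 'rV[int]_n.+1}) (c : {ffun N -> KC}).
Local Notation e_last := (delta_mx 0 ord_max : 'rV[KC]_n.+1).
Local Notation p := (@forget_last KC n).

(** A tangent space comes with unknown local equations; uniqueness lets the explicit ones replace
    them. *)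
Lemma stratum_tangent j x (T : 'M[KC]_n.+1) : regular_coefs c j.+1 -> stratum c j x ->
  is_tangent_space (stratum c j) x T ->
  (T == kermx ('J (stratum_equations c j) x))%MS.
Proof.
move=> rc Sx [k [g [lg /eqmxP Tg]]].
have /eqmxP G := kermx_jacobian_eq Sx lg (stratum_local_equations rc Sx).
by apply/eqmxP; exact: eqmx_trans Tg G.
Qed.

Lemma drop_stratum j x (T : 'M[KC]_n.+1) : regular_coefs c j.+1 -> stratum c j x ->
  (T == kermx ('J (stratum_equations c j) x))%MS ->
  (\rank (T *m 'J p x) < \rank T)%N <-> stratum c j.+1 x.
Proof.
move=> rc Sx /eqmxP TE; rewrite rank_forget_last_lt TE.
have eqv := e_last_stratum Sx.
split=> [/sub_kermxP/eqv Fj|[_ Fj]].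
  split; first exact: Sx.1.
  move=> l; rewrite leq_eqVlt ltnS => /predU1P[->//|lj].
  exact: Sx.2.
by apply/sub_kermxP/eqv; exact: Fj.
Qed.

(** By regularity tangent spaces have rank n - j, which is n for j = 0 and at most n always. So
    being critical (rank below n) and dropping rank (rank below the minimum of [\rank T] and n) both
    mean rank below [\rank T]. *)
Lemma thom_boardman_step j : regular_coefs c j.+1 ->
  thom_boardman p (stratum c 0) j = stratum c j ->
  thom_boardman p (stratum c 0) j.+1 = stratum c j.+1.
Proof.
move=> rc TBj.
have rkT x (T : 'M[KC]_n.+1) : stratum c j x -> (T == kermx ('J (stratum_equations c j) x))%MS ->
    \rank T = (n.+1 - j.+1)%N.
  by move=> Sx /eqmxP ->; rewrite mxrank_ker rank_stratum_equations.
have key x : stratum c j.+1 x <-> stratum c j x /\ exists T,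
    is_tangent_space (stratum c j) x T /\ (\rank (T *m 'J p x) < \rank T)%N.
  split=> [Sx|[Sx [T [tT drop]]]].
    have Sj : stratum c j x by split; [exact: Sx.1|move=> l lj; apply: Sx.2; exact: leqW].
    split=> //; exists (kermx ('J (stratum_equations c j) x)); split.
      exists j.+1, (stratum_equations c j); split; last by rewrite submx_refl.
      exact: stratum_local_equations.
    by apply/(drop_stratum rc Sj) => //; rewrite submx_refl.
  by apply/(drop_stratum rc Sx) => //; [exact: stratum_tangent tT|exact: drop].
rewrite predeqE => x; apply: iff_trans (iff_sym (key x)).
have sub (T : 'M[KC]_n.+1) : stratum c j x -> is_tangent_space (stratum c j) x T -> \rank T = (n.+1 - j.+1)%N.
  by move=> Sx tT; apply: (rkT x T Sx); exact: stratum_tangent tT.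
case: j rc TBj rkT key sub => [|j] rc TBj rkT key sub /=.
  rewrite /critical_locus /=; split=> -[Sx [T [tT drop]]]; split=> //; exists T; split=> //.
    by rewrite (sub _ Sx tT) subSS subn0.
  by move: drop; rewrite (sub _ Sx tT) subSS subn0.
rewrite -[X in rank_drop_locus _ X]/(thom_boardman p (stratum c 0) j.+1) TBj.
split=> -[Sx [T [tT drop]]]; split=> //; exists T; split=> //.
  by rewrite (leq_trans drop)// geq_minl.
rewrite leq_min drop /= (leq_trans drop)// (sub _ Sx tT).
by rewrite subSS leq_subr.
Qed.
End ThomBoardman.

(** A vanishing combination gives a polynomial of degree below [k] with a root at each of at least
    [k] values of h, hence the zero polynomial; evaluating it at 0, 1, 2, ... kills the coefficients
    one after the other. *)
Lemma falling_free (K : numFieldType) n (N : {fset 'rV[int]_n.+1}) (k : nat) :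
  (k <= #|` [fset last_coord b | b in N]%fset|)%N ->
  forall lam : 'I_k -> K,
  (forall b : N, \sum_l lam l * falling K l (last_coord (val b)) = 0) ->
  forall l, lam l = 0.
Proof.
move=> kN lam lam0.
pose ff l : {poly K} := \prod_(i < l) ('X - i%:R%:P).
pose Q : {poly K} := \sum_l lam l *: ff l.
have ffE l z : (ff l).[z] = \prod_(i < l) (z - i%:R).
  by rewrite horner_prod; apply: eq_bigr => i _; rewrite hornerXsubC.
have QE z : Q.[z] = \sum_l lam l * \prod_(i < l) (z - i%:R).
  by rewrite horner_sum; apply: eq_bigr => l _; rewrite hornerZ ffE.
have Q0 : Q = 0.
  apply/eqP; apply: contraT => QN0.
  pose rs := [seq (z%:~R : K) | z <- [fset last_coord b | b in N]%fset].
  have : (size rs < size Q)%N.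
    apply: max_poly_roots => //; last by rewrite map_inj_uniq ?fset_uniq//; exact: intr_inj.
    apply/allP => _ /mapP[z /imfsetP[b /= bN ->] ->]; apply/rootP; rewrite QE.
    exact: (lam0 [` bN]%fset).
  have szQ : (size Q <= k)%N.
    apply: leq_trans (size_sum _ _ _) _; apply/bigmax_leqP => l _.
    rewrite (leq_trans (size_scale_leq _ _))// /ff.
    rewrite -(big_mkord xpredT (fun i => 'X - (i%:R)%:P)) size_prod_XsubC size_iota subn0.
    exact: ltn_ord.
  rewrite size_map => /leq_trans/(_ szQ) => lt_k.
  by have := leq_trans lt_k kN; rewrite ltnn.
(* At i, falling factorials of degree above i vanish, those of lower degree have zero coefficient by
   induction, and that of degree i is nonzero in characteristic zero. *)
have lamE (i : nat) (ik : (i < k)%N) : lam (Ordinal ik) = 0.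
  elim/ltn_ind: i ik => i IHi ik.
  have := QE i%:R; rewrite Q0 horner0 (bigD1 (Ordinal ik))//= [X in _ = _ + X -> _]big1 => [|l li].
    rewrite addr0 => /esym/eqP; rewrite mulf_eq0 => /orP[/eqP//|].
    rewrite prodf_seq_eq0 => /hasP[j _ /=]; rewrite subr_eq0 eqr_nat => /eqP ij.
    by have := ltn_ord j; rewrite -ij ltnn.
  case: (ltngtP l i) => [l_i|i_l|e].
  - have -> : l = Ordinal (ltn_ord l) by apply/val_inj.
    by rewrite IHi// mul0r.
  - by rewrite (bigD1 (Ordinal i_l))//= subrr mul0r mulr0.
  - by case/eqP: li; apply/val_inj; rewrite /= e.
move=> l; have -> : l = Ordinal (ltn_ord l) by apply/val_inj.
exact: lamE.
Qed.

(** One open set must serve all [k] at once, since reaching a stratum uses regularity at every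
    earlier level; the finitely many polynomials are multiplied. *)
Lemma generic_regular (K : numFieldType) n (N : {fset 'rV[int]_n.+1}) :
  exists P, (exists c : {ffun N -> K}, poly_fun P c != 0) /\
    forall c, poly_fun P c != 0 ->
    forall k, (k <= #|` [fset last_coord b | b in N]%fset|)%N -> regular_coefs c k.
Proof.
have char0 (m : nat) : m.+1%:R != 0 :> K by rewrite pnatr_eq0.
set d := #|` _|.
suff H m : (m <= d.+1)%N -> exists P,
    (exists c : {ffun N -> K}, poly_fun P c != 0) /\
    forall c, poly_fun P c != 0 -> forall k, (k < m)%N -> regular_coefs c k.
  exact: (H d.+1).
elim: m => [_|m IHm md].
  by exists 1; split=> //; exists [ffun=> 0]; rewrite /poly_fun mpoly.meval1 oner_neq0.
have [P [P0 PP]] := IHm (ltnW md).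
have [Q [Q0 QQ]] := @generic_nondegenerate K N n.+1 m char0 (fun b s => (val b) 0 s)
  (fun l b => falling K l (last_coord (val b))) (falling_free md).
exists (P * Q); split; first exact: poly_fun_integral.
move=> c; rewrite poly_funM mulf_eq0 negb_or => /andP[Pc Qc] k.
by rewrite ltnS leq_eqVlt => /predU1P[->|km]; [exact: QQ|exact: PP].
Qed.

Lemma thom_boardman_stratum (R : realType) n (N : {fset 'rV[int]_n.+1})
    (c : {ffun N -> complex_field R}) i :
  (forall k, (k <= i)%N -> regular_coefs c k) ->
  thom_boardman (@forget_last (complex_field R) n) (stratum c 0) i = stratum c i.
Proof.
elim: i => // i IHi rc; apply: thom_boardman_step; first exact: rc.
by apply: IHi => k ki; apply: rc; exact: leqW.
Qed.

Lemma stratumE (K : numFieldType) n (N : {fset 'rV[int]_n.+1}) (c : {ffun N -> K}) i :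
  stratum c i = torus (n := n.+1) `&`
    [set x | forall j : nat, (j <= i)%N -> iter j (dlast (n := n)) (laurent c) x = 0].
Proof.
rewrite predeqE => x; split=> -[tx Fx]; split=> // j ji.
  by rewrite iter_dlast// Fx// mul0r.
have xj : x 0 ord_max ^- j != 0 by rewrite invr_neq0 ?expf_neq0//; exact: tx.
by apply: (mulIf xj); rewrite mul0r -iter_dlast// Fx.
Qed.

Unset Implicit Arguments.

Theorem theorem4p3 (R : realType) (n : nat) (V : seq 'rV[R]_n.+1)
    (N : {fset 'rV[int]_n.+1}) (hN : is_lattice_points (polytope V) N) :
  exists U : set {ffun N -> R[i]},
    [/\ zariski_open U, U !=set0 &
        forall c : {ffun N -> R[i]}, U c ->
          let f := laurent c in
          let hypersurface := torus (n := n.+1) `&` [set x | f x = 0] in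
          let p := forget_last (C := R[i]) (n := n) in
          forall i : nat, (1 <= i < #|` [fset last_coord b | b in N]%fset|)%N ->
            thom_boardman_defined p hypersurface i /\
            thom_boardman p hypersurface i =
              torus (n := n.+1) `&`
              [set x | forall j : nat, (j <= i)%N ->
                         iter j (dlast (n := n)) f x = 0]].
Proof.
have [P [[c0 Pc0] Preg]] := generic_regular (complex_field R) N.
exists [set c | poly_fun P c != 0]; split.
- exists [set P]; apply/seteqP; split=> c /=; first by exists P.
  by move=> [_ ->].
- by exists c0.
move=> c Pc f hypersurface p i /andP[_ iN].
have rc k : (k <= i)%N -> regular_coefs (c : {ffun N -> complex_field R}) k.
  by move=> ki; apply: Preg => //; exact: leq_trans ki (ltnW iN).
have -> : hypersurface = stratum (c : {ffun N -> complex_field R}) 0.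
  rewrite stratumE predeqE => x; split=> -[tx fx]; split; try exact: tx.
    by move=> j; rewrite leqn0 => /eqP ->.
  exact: (fx 0%N).
split; last by rewrite -stratumE; exact: thom_boardman_stratum.
move=> j ji.
rewrite -[thom_boardman _ _ _]/(thom_boardman (@forget_last (complex_field R) n) (stratum (c : {ffun N -> complex_field R}) 0) j).
rewrite thom_boardman_stratum => [x Sx|k kj]; last by apply: rc; exact: leq_trans kj (ltnW ji).
exists j.+1, (stratum_equations (c : {ffun N -> complex_field R}) j).
by apply: stratum_local_equations => //; exact: rc.
Qed.
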